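(* Let $X$, $A$, $B$, $C$, $Y$, $G_+$, $G_-$ be as in the context. Then $G_+$ and $G_-$ are infinitesimal generators of strongly continuous semigroups $T_+:[0,\infty)\to L(Y,Y)$ and $T_-:[0,\infty)\to L(Y,Y)$, respectively. If $\mu_\pm\in\mathbb{R}$ are such that $\mathrm{Re}(\xi|G_\pm\xi)\geqslant-\mu_\pm(\xi|\xi)$ for all $\xi\in D(H)$, then the spectra of $G_+$ and $G_-$ are contained in $\{z\in\mathbb{C}:\mathrm{Re}\,z\geqslant-\mu_+\}$ and $\{z\in\mathbb{C}:\mathrm{Re}\,z\geqslant-\mu_-\}$, respectively, and $|T_+(t)|\leqslant\exp(\mu_+t)$, $|T_-(t)|\leqslant\exp(\mu_-t)$ for all $t\in[0,\infty)$.
   Context: $(X,\langle\cdot|\cdot\rangle)$ is a nontrivial complex Hilbert space with norm $\|\cdot\|$. $A:D(A)\to X$ is a densely defined self-adjoint linear operator with $\langle\xi|A\xi\rangle\geqslant\varepsilon\langle\xi|\xi\rangle$ for all $\xi\in D(A)$ for some $\varepsilon>0$; $A^{1/2}$ is its positive self-adjoint square root. $B:D(A^{1/2})\to X$ is linear with $\|B\xi\|^2\leqslant a^2\|A^{1/2}\xi\|^2+b^2\|\xi\|^2$ for all $\xi\in D(A^{1/2})$, for some $a\in[0,1)$, $b\in\mathbb{R}$, and $B$ is symmetric or bounded. $C:D(A^{1/2})\to X$ is linear with $\|C\xi\|^2\leqslant c^2\|A^{1/2}\xi\|^2+d^2\|\xi\|^2$ for all $\xi\in D(A^{1/2})$,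 for some real $c,d$. $Y:=D(A^{1/2})\times X$ with inner product $(\xi|\eta):=\langle A^{1/2}\xi_1|A^{1/2}\eta_1\rangle+\langle\xi_2|\eta_2\rangle$ and norm $|\cdot|$ (also used for operator norms on $Y$). $H:D(A)\times D(A^{1/2})\to Y$, $H\xi:=(-i\xi_2,iA\xi_1)$; $\hat B:D(H)\to Y$, $\hat B\xi:=(0,-B\xi_2)$; $V:Y\to Y$, $V\xi:=(0,iC\xi_1)$; $G_+:=-i(H+\hat B+V)$, $G_-:=i(H+\hat B+V)$ with domain $D(H)$. Convention: $G$ is the infinitesimal generator of the semigroup $S$ if $S(t)=e^{-tG}$, i.e. $\frac{d}{dt}S(t)\xi=-GS(t)\xi$ for $\xi\in D(G)$. *)

(* Defs.v *)
From Stdlib Require Import Reals.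
From Coquelicot Require Import Coquelicot.
Open Scope R_scope.

Section Defs.
Variable X : CompleteNormedModule C_AbsRing.

(** Complex Hilbert space structure on X: a complete normed C-module whose
    norm comes from an inner product <x|y>, conjugate-linear in the first and
    linear in the second argument (physics convention, as in the paper). *)
Record is_inner_product (ip : X -> X -> C) : Prop := {
  ip_addr : forall x y z, ip x (plus y z) = Cplus (ip x y) (ip x z);
  ip_scalr : forall (a : C) x y, ip x (scal a y) = Cmult a (ip x y);
  ip_conj : forall x y, ip y x = Cconj (ip x y);
  ip_norm : forall x, ip x x = RtoC (norm x ^ 2)
}.

(** Partial operators: a domain predicate and a function. *)
Definition is_subspace (D : X -> Prop) : Prop :=
  D zero /\ (forall x y, D x -> D y -> D (plus x y)) /\
  (forall (a : C) x, D x -> D (scal a x)).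

Definition linear_on (D : X -> Prop) (T : X -> X) : Prop :=
  is_subspace D /\
  (forall x y, D x -> D y -> T (plus x y) = plus (T x) (T y)) /\
  (forall (a : C) x, D x -> T (scal a x) = scal a (T x)).

Definition densely_defined (D : X -> Prop) : Prop :=
  forall x (e : R), 0 < e -> exists y, D y /\ norm (minus x y) < e.

(** T (with domain D) equals its adjoint T^*:
    D(T^* ) = { y | exists w, forall x in D, <y|Tx> = <w|x> },  T^* y = w. *)
Definition self_adjoint (ip : X -> X -> C) (D : X -> Prop) (T : X -> X) : Prop :=
  (forall y, D y <-> exists w, forall x, D x -> ip y (T x) = ip w x) /\
  (forall x y, D x -> D y -> ip y (T x) = ip (T y) x).

Definition pos_sqrt (ip : X -> X -> C) (DA : X -> Prop) (A : X -> X)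
  (DS : X -> Prop) (S : X -> X) : Prop :=
  linear_on DS S /\ self_adjoint ip DS S /\
  (forall x, DS x -> 0 <= Re (ip x (S x))) /\
  (forall x, DA x <-> (DS x /\ DS (S x))) /\
  (forall x, DA x -> A x = S (S x)).

(** The energy space Y = D(A^{1/2}) x X, with
    (xi|eta) = <S xi1|S eta1> + <xi2|eta2>,  |xi| = sqrt Re (xi|xi). *)
Definition inY (DS : X -> Prop) (p : X * X) : Prop := DS (fst p).

Definition innerY (ip : X -> X -> C) (S : X -> X) (p q : X * X) : C :=
  Cplus (ip (S (fst p)) (S (fst q))) (ip (snd p) (snd q)).

Definition normY (ip : X -> X -> C) (S : X -> X) (p : X * X) : R :=
  sqrt (Re (innerY ip S p p)).

Definition plusY (p q : X * X) : X * X := (plus (fst p) (fst q), plus (snd p) (snd q)).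
Definition scalY (a : C) (p : X * X) : X * X := (scal a (fst p), scal a (snd p)).
Definition minusY (p q : X * X) : X * X := (minus (fst p) (fst q), minus (snd p) (snd q)).

Definition H_op (A : X -> X) (p : X * X) : X * X :=
  (scal (Copp Ci) (snd p), scal Ci (A (fst p))).
Definition Bhat_op (B : X -> X) (p : X * X) : X * X :=
  (zero, opp (B (snd p))).
Definition V_op (Cop : X -> X) (p : X * X) : X * X :=
  (zero, scal Ci (Cop (fst p))).
Definition DH (DA DS : X -> Prop) (p : X * X) : Prop := DA (fst p) /\ DS (snd p).
Definition Gplus (A B Cop : X -> X) (p : X * X) : X * X :=
  scalY (Copp Ci) (plusY (plusY (H_op A p) (Bhat_op B p)) (V_op Cop p)).
Definition Gminus (A B Cop : X -> X) (p : X * X) : X * X :=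
  scalY Ci (plusY (plusY (H_op A p) (Bhat_op B p)) (V_op Cop p)).

Section OnY.
Variables (ip : X -> X -> C) (DS : X -> Prop) (S : X -> X).
Let Y := inY DS.
Let nY := normY ip S.

Definition bounded_linear_Y (T : X * X -> X * X) : Prop :=
  (forall p, Y p -> Y (T p)) /\
  (forall p q, Y p -> Y q -> T (plusY p q) = plusY (T p) (T q)) /\
  (forall (a : C) p, Y p -> T (scalY a p) = scalY a (T p)) /\
  (exists M : R, forall p, Y p -> nY (T p) <= M * nY p).

Definition sc_semigroup (T : R -> X * X -> X * X) : Prop :=
  (forall t, 0 <= t -> bounded_linear_Y (T t)) /\
  (forall p, Y p -> T 0 p = p) /\
  (forall s t p, 0 <= s -> 0 <= t -> Y p -> T (s + t) p = T s (T t p)) /\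
  (forall p, Y p -> forall e, 0 < e -> exists d, 0 < d /\
      forall t, 0 <= t < d -> nY (minusY (T t p) p) < e).

(** G (domain DG) is the infinitesimal generator of T, with the convention
    T(t) = exp(-tG):  D(G) = { p in Y | lim_{t->0+} (T t p - p)/t exists in Y }
    and  -G p  is that limit. *)
Definition right_limit_Y (f : R -> X * X) (l : X * X) : Prop :=
  forall e, 0 < e -> exists d, 0 < d /\
    forall t, 0 < t < d -> nY (minusY (f t) l) < e.

Definition generator (DG : X * X -> Prop) (G : X * X -> X * X)
  (T : R -> X * X -> X * X) : Prop :=
  (forall p, DG p <->
    (Y p /\ exists l, Y l /\
       right_limit_Y (fun t => scalY (RtoC (/ t)) (minusY (T t p) p)) l)) /\
  (forall p, DG p ->
     right_limit_Y (fun t => scalY (RtoC (/ t)) (minusY (T t p) p))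
                   (scalY (RtoC (-1)) (G p))).

Definition resolvent (DG : X * X -> Prop) (G : X * X -> X * X) (z : C) : Prop :=
  exists Rz : X * X -> X * X,
    (forall q, Y q -> DG (Rz q) /\ minusY (G (Rz q)) (scalY z (Rz q)) = q) /\
    (forall p, DG p -> Rz (minusY (G p) (scalY z p)) = p) /\
    (exists M : R, forall q, Y q -> nY (Rz q) <= M * nY q).

Definition in_spectrum (DG : X * X -> Prop) (G : X * X -> X * X) (z : C) : Prop :=
  ~ resolvent DG G z.
End OnY.
End Defs.

(* Main.v *)
Require Import Defs.
From Stdlib Require Import Reals Lra Lia Classical ClassicalEpsilon.
From Coquelicot Require Import Coquelicot.
Open Scope R_scope.

(** The map [(xi1, xi2) |-> (S xi1, +- xi2)], with [S = A^(1/2)], is an isometry of the energy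
    space onto [X * X]; it turns both [G_+] (sign [+]) and [G_-] (sign [-], with [B] replaced by
    [- B]) into [(u, v) |-> (- S v, S u + i B v + C S^-1 u)] on [D(S) x D(S)].  The part
    [(- S v, S u)] is skew, [C S^-1] is bounded and [Re (i <v|B v>)] is controlled, so the
    operator is quasi-accretive; since [a < 1], for large real [L] it is a small perturbation of
    the skew part plus [L], whose inverse is explicit in terms of [(L^2 + A)^-1], so it is onto.
    Let [m] be the least constant making [G + m] accretive.  The semigroup of [G + m] is the limit
    of [((1 + t/2^n (G + m))^-1)^(2^n)]: on [D(G^2)] the identity
    [(1 + aG)(1 + bG) - (1 + (a + b)G) = ab G^2] gives geometric convergence and, in the limit,
    the semigroup law.  Minimality of [m] makes the bounds hold for every admissible [mu]. *)

(** * Products of complete normed modules *)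

(** The energy space is only a predicate on [X * X] with a norm of its own, whereas the limit
    arguments live in a complete normed module; after the isometry, completeness of [X] suffices.
    Invertibility of [L^2 + A] is obtained by minimising [|T x - f|], and the same argument with
    shift zero yields [S^-1]. The condition [a < 1] enters through the exact formula
    [L^2 (|u|^2 + |v|^2) + |S u|^2 + |S v|^2] for the squared norm of the skew part plus [L] at
    [(u, v)]: relative to it [B] keeps a bound below 1, while [C S^-1] contributes only a multiple
    of [1 / L]. Step counts are powers of two so that consecutive approximations can be compared
    block by block, without integrals or differential equations. The semigroup has to be fixed
    before [mu] is given, which forces the choice of one optimal constant; since [X] is nontrivial,
    the admissible constants are bounded below and such an optimum exists. *)

Lemma prod_complete_lim (U V : CompleteSpace) (F : (U * V -> Prop) -> Prop) :
  ProperFilter F -> cauchy (T := prod_UniformSpace U V) F -> forall eps : posreal,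
  F (ball (M := prod_UniformSpace U V) (lim (filtermap fst F), lim (filtermap snd F)) eps).
Proof.
  intros PF HF eps.
  assert (H1 : F (fun p => ball (lim (filtermap fst F)) eps (fst p))).
  { apply (complete_cauchy (filtermap fst F) (filtermap_proper_filter _ _ _ _ PF)).
    intros e. destruct (HF e) as [p Hp]. exists (fst p).
    revert Hp. unfold filtermap. apply filter_imp. intros q [Hq _]. exact Hq. }
  assert (H2 : F (fun p => ball (lim (filtermap snd F)) eps (snd p))).
  { apply (complete_cauchy (filtermap snd F) (filtermap_proper_filter _ _ _ _ PF)).
    intros e. destruct (HF e) as [p Hp]. exists (snd p).
    revert Hp. unfold filtermap. apply filter_imp. intros q [_ Hq]. exact Hq. }
  generalize (filter_and _ _ H1 H2). apply filter_imp. intros p [Ha Hb]. split; assumption.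
Qed.

Lemma prod_close_lim (U V : CompleteSpace) (F1 F2 : (U * V -> Prop) -> Prop) :
  filter_le F1 F2 -> filter_le F2 F1 ->
  close (M := prod_UniformSpace U V) (lim (filtermap fst F1), lim (filtermap snd F1))
        (lim (filtermap fst F2), lim (filtermap snd F2)).
Proof.
  intros H12 H21 eps. split; apply close_lim; unfold filter_le, filtermap; auto.
Qed.

Definition prod_CompleteSpace_mixin (U V : CompleteSpace) :=
  CompleteSpace.Mixin (prod_UniformSpace U V) _ (prod_complete_lim U V) (prod_close_lim U V).

(** Canonical, so that everything proved for a generic complete module [Z] applies to [X * X]. The
    norm is the Euclidean one, which is what makes the map from the energy space an isometry. *)
Canonical prod_CompleteNormedModule (K : AbsRing) (U V : CompleteNormedModule K) :=
  CompleteNormedModule.Pack K (U * V)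
    (CompleteNormedModule.Class K (U * V) (NormedModule.class K (prod_NormedModule K U V))
       (prod_CompleteSpace_mixin U V)) (U * V).

(** Submultiplicativity applied to [a] and to its inverse gives the two inequalities. *)
Lemma norm_scal_C {Z : CompleteNormedModule C_AbsRing} (a : C) (x : Z) : norm (scal a x) = Cmod a * norm x.
Proof.
  apply Rle_antisym; [exact (norm_scal (K := C_AbsRing) a x)|].
  destruct (Ceq_dec a (RtoC 0)) as [->|N].
  { rewrite Cmod_0, Rmult_0_l. apply norm_ge_0. }
  assert (E : scal (Cinv a) (scal a x) = x).
  { rewrite scal_assoc. change (mult (Cinv a) a) with (Cmult (Cinv a) a).
    rewrite Cinv_l by assumption. apply (scal_one x). }
  assert (H : norm x <= Cmod (Cinv a) * norm (scal a x)).
  { rewrite <- E at 1. exact (norm_scal (K := C_AbsRing) (Cinv a) (scal a x)). }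
  rewrite Cmod_inv in H by assumption.
  pose proof (Cmod_gt_0 a) as [Hg _]. specialize (Hg N).
  apply (Rmult_le_compat_l (Cmod a)) in H; [|lra].
  rewrite <- Rmult_assoc, Rinv_r, Rmult_1_l in H by lra. exact H.
Qed.

Lemma norm_minus_self {Z : CompleteNormedModule C_AbsRing} (x : Z) : norm (minus x x) = 0.
Proof. exact (eq_trans (f_equal norm (minus_eq_zero x)) (norm_zero (V := Z))). Qed.

Lemma norm_minus_sym {Z : CompleteNormedModule C_AbsRing} (x y : Z) : norm (minus x y) = norm (minus y x).
Proof. rewrite <- (norm_opp (minus y x)), opp_minus. reflexivity. Qed.

Lemma norm_minus_le {Z : CompleteNormedModule C_AbsRing} (x y : Z) : norm (minus x y) <= norm x + norm y.
Proof. rewrite <- (norm_opp y). exact (norm_triangle x (opp y)). Qed.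

Lemma norm_dist_triangle {Z : CompleteNormedModule C_AbsRing} (y x z : Z) :
  norm (minus x z) <= norm (minus x y) + norm (minus y z).
Proof. rewrite (minus_trans y x z). exact (norm_triangle (minus x y) (minus y z)). Qed.

Lemma minus_eq_zero_eq {Z : AbelianGroup} (x y : Z) : minus x y = zero -> x = y.
Proof.
  intros E. apply (plus_reg_r (opp y)). exact (eq_trans E (eq_sym (plus_opp_r y))).
Qed.

Lemma norm_dist_zero_eq {Z : CompleteNormedModule C_AbsRing} (x y : Z) : norm (minus x y) <= 0 -> x = y.
Proof.
  intros H. apply (minus_eq_zero_eq x y). apply (norm_eq_zero (minus x y)). pose proof (norm_ge_0 (minus x y)). lra.
Qed.

Lemma norm_dist_lt_all_eq {Z : CompleteNormedModule C_AbsRing} (x y : Z) (k : R) :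
  (forall e, 0 < e -> norm (minus x y) <= k * e) -> x = y.
Proof.
  intros H. apply norm_dist_zero_eq. destruct (Rle_lt_dec k 0) as [Hk|Hk].
  - specialize (H 1 Rlt_0_1). lra.
  - apply le_epsilon. intros e He. rewrite Rplus_0_l. replace e with (k * (e / k)) by (field; lra).
    apply H. apply Rdiv_lt_0_compat; lra.
Qed.

(** * Inner products *)

Section InnerProduct.
Context {Z : CompleteNormedModule C_AbsRing} {ip : Z -> Z -> C}.
Hypothesis Hip : is_inner_product Z ip.

Lemma ip_plus_r x y z : ip x (plus y z) = Cplus (ip x y) (ip x z).
Proof. apply (ip_addr _ _ Hip). Qed.

Lemma ip_scal_r (a : C) x y : ip x (scal a y) = Cmult a (ip x y).
Proof. apply (ip_scalr _ _ Hip). Qed.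

Lemma ip_sym x y : ip y x = Cconj (ip x y).
Proof. apply (ip_conj _ _ Hip). Qed.

Lemma ip_zero_r x : ip x zero = RtoC 0.
Proof.
  replace (ip x zero) with (ip x (scal (RtoC 0) zero))
    by (f_equal; exact (scal_zero_r (V := CompleteNormedModule.ModuleSpace C_AbsRing Z) (RtoC 0))).
  rewrite ip_scal_r. apply Cmult_0_l. Qed.

Lemma ip_opp_r x y : ip x (opp y) = Copp (ip x y).
Proof.
  replace (ip x (opp y)) with (ip x (scal (Copp (RtoC 1)) y))
    by (f_equal; exact (scal_opp_one (V := CompleteNormedModule.ModuleSpace C_AbsRing Z) y)).
  rewrite ip_scal_r. ring.
Qed.

Lemma ip_minus_r x y z : ip x (minus y z) = Cminus (ip x y) (ip x z).
Proof. unfold minus. rewrite ip_plus_r, ip_opp_r. reflexivity. Qed.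

Lemma ip_plus_l x y z : ip (plus x y) z = Cplus (ip x z) (ip y z).
Proof. rewrite ip_sym, ip_plus_r, Cplus_conj, <- !ip_sym. reflexivity. Qed.

Lemma ip_scal_l (a : C) x y : ip (scal a x) y = Cmult (Cconj a) (ip x y).
Proof. rewrite ip_sym, ip_scal_r, Cmult_conj, <- !ip_sym. reflexivity. Qed.

Lemma ip_opp_l x y : ip (opp x) y = Copp (ip x y).
Proof. rewrite ip_sym, ip_opp_r, Copp_conj, <- !ip_sym. reflexivity. Qed.

Lemma ip_minus_l x y z : ip (minus x y) z = Cminus (ip x z) (ip y z).
Proof. unfold minus. rewrite ip_plus_l, ip_opp_l. reflexivity. Qed.

Lemma ip_zero_l x : ip zero x = RtoC 0.
Proof. rewrite ip_sym, ip_zero_r. unfold Cconj, RtoC; simpl. f_equal. ring. Qed.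

Lemma Re_ip_self x : Re (ip x x) = norm x ^ 2.
Proof. rewrite (ip_norm _ _ Hip). reflexivity. Qed.

Lemma ip_self_eq_zero x : Re (ip x x) <= 0 -> x = zero.
Proof.
  rewrite Re_ip_self. intros H. apply (norm_eq_zero x). pose proof (norm_ge_0 x). nra.
Qed.

Lemma ip_ext x y : (forall z, ip z x = ip z y) -> x = y.
Proof.
  intros H. apply (minus_eq_zero_eq x y). apply (ip_self_eq_zero (minus x y)).
  rewrite ip_minus_r, (H (minus x y)). unfold Cminus. rewrite Cplus_opp_r. simpl. lra.
Qed.

Lemma Re_ip_sym x y : Re (ip y x) = Re (ip x y).
Proof. rewrite ip_sym. reflexivity. Qed.

Lemma norm_plus_sqr x y : norm (plus x y) ^ 2 = norm x ^ 2 + 2 * Re (ip x y) + norm y ^ 2.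
Proof.
  rewrite <- !Re_ip_self, ip_plus_r, !ip_plus_l. pose proof (Re_ip_sym x y) as E.
  unfold Re in *. unfold Cplus; simpl. lra.
Qed.

Lemma Re_ip_le x y : Re (ip x y) <= norm x * norm y.
Proof.
  pose proof (norm_ge_0 x) as Hx. pose proof (norm_ge_0 y) as Hy.
  destruct (Req_dec (norm x) 0) as [Ex|Nx].
  { rewrite (norm_eq_zero x Ex), ip_zero_l, norm_zero. simpl. lra. }
  destruct (Req_dec (norm y) 0) as [Ey|Ny].
  { rewrite (norm_eq_zero y Ey), ip_zero_r, norm_zero. simpl. lra. }
  (* The square expands to [2 |x| |y| (|x| |y| - Re <x|y>)]. *)
  assert (E : 0 <= Re (ip (minus (scal (RtoC (norm y)) x) (scal (RtoC (norm x)) y))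
                      (minus (scal (RtoC (norm y)) x) (scal (RtoC (norm x)) y)))).
  { rewrite Re_ip_self. apply pow2_ge_0. }
  rewrite ip_minus_r, !ip_minus_l, !ip_scal_r, !ip_scal_l in E.
  pose proof (Re_ip_self x) as E1. pose proof (Re_ip_self y) as E2. pose proof (Re_ip_sym x y) as E3.
  unfold Re in *. unfold Cminus, Cplus, Copp, Cmult, Cconj, RtoC in E; simpl in E.
  rewrite E3, E1, E2 in E. assert (0 < norm x * norm y) by nra. nra.
Qed.

(** Scaling [y] by the conjugate of [<x|y>] turns the inner product into the real number
    [|<x|y>|^2], so the bound on the real part is enough. *)
Lemma Cmod_ip_le x y : Cmod (ip x y) <= norm x * norm y.
Proof.
  pose proof (norm_ge_0 x) as Hx. pose proof (norm_ge_0 y) as Hy.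
  destruct (Req_dec (Cmod (ip x y)) 0) as [E0|N0]; [rewrite E0; nra|].
  pose proof (Cmod_ge_0 (ip x y)).
  assert (H1 := Re_ip_le x (scal (Cconj (ip x y)) y)). rewrite ip_scal_r in H1.
  assert (E : Re (Cconj (ip x y) * ip x y)%C = Cmod (ip x y) ^ 2).
  { unfold Cmod. rewrite pow2_sqrt by nra. unfold Cconj, Cmult, Re; simpl. ring. }
  rewrite E in H1.
  rewrite norm_scal_C, Cmod_conj in H1.
  assert (0 < Cmod (ip x y)) by lra. nra.
Qed.

(** Cauchy-Schwarz with one factor [|x|] cancelled. It turns every coercivity or accretivity
    hypothesis into a lower bound for a norm, hence into injectivity and an inverse bound. *)
Lemma norm_le_lower_bound (x y : Z) (k : R) : k * norm x ^ 2 <= Re (ip x y) -> k * norm x <= norm y.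
Proof.
  intros H. pose proof (Re_ip_le x y). pose proof (norm_ge_0 x). pose proof (norm_ge_0 y).
  destruct (Req_dec (norm x) 0) as [E|N]; [rewrite E; lra|]. nra.
Qed.

End InnerProduct.

(* An identity between vectors is checked against every [ip z _], where it becomes a ring
   identity in [C]. *)
Ltac ip_simpl Hip :=
  repeat (rewrite (ip_plus_r Hip) || rewrite (ip_scal_r Hip) || rewrite (ip_minus_r Hip)
          || rewrite (ip_opp_r Hip) || rewrite (ip_zero_r Hip)).
Ltac vec Hip := apply (ip_ext Hip); intro; ip_simpl Hip; try ring.

Definition ip_prod {X : CompleteNormedModule C_AbsRing} (ip : X -> X -> C) (p q : X * X) : C :=
  Cplus (ip (fst p) (fst q)) (ip (snd p) (snd q)).

Lemma norm_prod_sqr {X : CompleteNormedModule C_AbsRing}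
  (p : prod_CompleteNormedModule C_AbsRing X X) :
  norm p ^ 2 = norm (fst p) ^ 2 + norm (snd p) ^ 2.
Proof.
  change (norm p) with (sqrt (norm (fst p) ^ 2 + norm (snd p) ^ 2)).
  apply pow2_sqrt. pose proof (pow2_ge_0 (norm (fst p))). pose proof (pow2_ge_0 (norm (snd p))). lra.
Qed.

Lemma ip_prod_is_inner_product {X : CompleteNormedModule C_AbsRing} (ip : X -> X -> C) :
  is_inner_product X ip -> is_inner_product (prod_CompleteNormedModule C_AbsRing X X) (ip_prod ip).
Proof.
  intros Hip. split.
  - intros [x1 x2] [y1 y2] [z1 z2]. unfold ip_prod; simpl.
    change (plus (y1, y2) (z1, z2)) with (plus y1 z1, plus y2 z2); simpl. ip_simpl Hip. ring.
  - intros k [x1 x2] [y1 y2]. unfold ip_prod.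
    change (scal k (y1, y2)) with (scal k y1, scal k y2); simpl. ip_simpl Hip. ring.
  - intros x y. unfold ip_prod. rewrite Cplus_conj, <- !(ip_sym Hip). reflexivity.
  - intros x. unfold ip_prod. rewrite !(ip_norm _ _ Hip), norm_prod_sqr, RtoC_plus. reflexivity.
Qed.

(** * Convergence and surjectivity *)

Section Convergence.
Context {Z : CompleteNormedModule C_AbsRing}.

Definition converges (u : nat -> Z) (l : Z) : Prop :=
  forall e, 0 < e -> exists N, forall n, (N <= n)%nat -> norm (minus (u n) l) < e.

Lemma cauchy_converges (u : nat -> Z) :
  (forall e, 0 < e -> exists N, forall n m, (N <= n)%nat -> (N <= m)%nat ->
     norm (minus (u n) (u m)) < e) ->
  exists l, converges u l.
Proof.
  intros H.
  destruct (proj1 (filterlim_locally_cauchy (U := Z) (F := eventually) u)) as [l Hl].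
  - intros eps. destruct (H eps (cond_pos eps)) as [N HN].
    exists (fun n => (N <= n)%nat). split; [exists N; auto|].
    intros n m Hn Hm. apply (norm_compat1 (u n) (u m)). apply HN; assumption.
  - exists l. intros e He.
    destruct (proj1 (filterlim_locally_ball_norm (K := C_AbsRing) (U := Z) (F := eventually) u l) Hl
                (mkposreal e He)) as [N HN].
    exists N. exact HN.
Qed.

Lemma converges_dist_le u l y M : converges u l -> (forall n, norm (minus (u n) y) <= M) ->
  norm (minus l y) <= M.
Proof.
  intros Hl HM. apply le_epsilon. intros e He. destruct (Hl e He) as [N HN].
  pose proof (norm_dist_triangle (u N) l y) as Ht. specialize (HN N (le_n N)).
  rewrite norm_minus_sym in HN. specialize (HM N). lra.
Qed.

Lemma converges_le u l M : converges u l -> (forall n, norm (u n) <= M) -> norm l <= M.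
Proof.
  intros Hl HM. rewrite <- (minus_zero_r l). apply (converges_dist_le u l zero M Hl).
  intros n. rewrite minus_zero_r. apply HM.
Qed.

Lemma converges_unique u l1 l2 : converges u l1 -> converges u l2 -> l1 = l2.
Proof.
  intros H1 H2. apply (norm_dist_lt_all_eq _ _ 2). intros e He.
  destruct (H1 e He) as [N1 HN1]. destruct (H2 e He) as [N2 HN2].
  specialize (HN1 (N1 + N2)%nat ltac:(lia)). specialize (HN2 (N1 + N2)%nat ltac:(lia)).
  pose proof (norm_dist_triangle (u (N1 + N2)%nat) l1 l2).
  rewrite (norm_minus_sym l1 (u _)) in H. lra.
Qed.

Lemma converges_of_lipschitz_image (u v : nat -> Z) (k : R) (l m : Z) :
  (forall n, norm (minus (v n) m) <= k * norm (minus (u n) l)) -> converges u l -> converges v m.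
Proof.
  intros H Hu e He. destruct (Hu (e / (Rabs k + 1))) as [N HN].
  { apply Rdiv_lt_0_compat; [lra|]. pose proof (Rabs_pos k). lra. }
  exists N. intros n Hn. specialize (HN n Hn). specialize (H n).
  pose proof (Rabs_pos k). pose proof (Rle_abs k). pose proof (norm_ge_0 (minus (u n) l)).
  apply (Rmult_lt_compat_r (Rabs k + 1)) in HN; [|lra].
  unfold Rdiv in HN. rewrite Rmult_assoc, Rinv_l, Rmult_1_r in HN by lra. nra.
Qed.

Lemma banach_fixed_point (f : Z -> Z) (q : R) : 0 <= q < 1 ->
  (forall x y, norm (minus (f x) (f y)) <= q * norm (minus x y)) -> exists x, f x = x.
Proof.
  intros Hq Hf. set (u := fun n => Nat.iter n f zero). set (c := norm (minus (u 1%nat) (u 0%nat))).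
  assert (Hc : 0 <= c) by apply norm_ge_0.
  assert (Hstep : forall n, norm (minus (u (S n)) (u n)) <= c * q ^ n).
  { induction n as [|n IH]; [simpl; fold (u 1%nat); unfold c; simpl; lra|].
    change (u (S (S n))) with (f (u (S n))). change (u (S n)) with (f (u n)) at 2.
    apply Rle_trans with (1 := Hf _ _). replace (c * q ^ S n) with (q * (c * q ^ n)) by (simpl; ring).
    apply Rmult_le_compat_l; [lra|exact IH]. }
  (* The geometric sum [c q^n (1 + ... + q^(k-1))] with the denominator [1 - q] cleared, so that the
     induction stays polynomial. *)
  assert (Hk : forall n k, norm (minus (u (k + n)%nat) (u n)) * (1 - q) <= c * q ^ n * (1 - q ^ k)).
  { intros n. induction k as [|k IH].
    - simpl. rewrite norm_minus_self. lra.
    - pose proof (norm_dist_triangle (u (k + n)%nat) (u (S k + n)%nat) (u n)).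
      specialize (Hstep (k + n)%nat). simpl in *. rewrite pow_add in Hstep.
      assert (norm (minus (f (u (k + n)%nat)) (u (k + n)%nat)) * (1 - q) <= c * (q ^ k * q ^ n) * (1 - q)).
      { apply Rmult_le_compat_r; [lra|exact Hstep]. }
      apply (Rmult_le_compat_r (1 - q)) in H; [|lra]. unfold u in *. simpl in *. nra. }
  assert (Hu : forall e, 0 < e -> exists N, forall k, norm (minus (u (k + N)%nat) (u N)) < e).
  { intros e He. destruct (pow_lt_1_zero q) with (y := e * (1 - q) / (c + 1)) as [N HN].
    - rewrite Rabs_pos_eq; lra.
    - apply Rdiv_lt_0_compat; nra.
    - exists N. intros k. specialize (HN N (le_n N)). specialize (Hk N k).
      rewrite Rabs_pos_eq in HN by (apply pow_le; lra).
      assert (0 <= q ^ k) by (apply pow_le; lra). assert (0 <= q ^ N) by (apply pow_le; lra).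
      apply (Rmult_lt_compat_r (c + 1)) in HN; [|lra].
      unfold Rdiv in HN. rewrite Rmult_assoc, Rinv_l, Rmult_1_r in HN by lra.
      assert (0 <= c * q ^ N * q ^ k) by (apply Rmult_le_pos; nra).
      apply Rmult_lt_reg_r with (1 - q); nra. }
  destruct (cauchy_converges u) as [l Hl].
  { intros e He. destruct (Hu (e / 2)) as [N HN]; [lra|]. exists N. intros n m Hn Hm.
    pose proof (HN (n - N)%nat) as H1. pose proof (HN (m - N)%nat) as H2.
    replace (n - N + N)%nat with n in H1 by lia. replace (m - N + N)%nat with m in H2 by lia.
    rewrite norm_minus_sym in H2. pose proof (norm_dist_triangle (u N) (u n) (u m)). lra. }
  exists l. apply (norm_dist_lt_all_eq _ _ 2). intros e He. destruct (Hl e He) as [N HN].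
  pose proof (HN (S N) ltac:(lia)) as H1. pose proof (HN N (le_n N)) as H2.
  pose proof (norm_dist_triangle (f (u N)) (f l) l) as H3. pose proof (Hf l (u N)) as H4.
  rewrite (norm_minus_sym l) in H4. change (f (u N)) with (u (S N)) in *.
  pose proof (norm_ge_0 (minus (u N) l)). nra.
Qed.

End Convergence.

(** * Partial linear operators and their small perturbations *)

Section Linear.
Context {Z : CompleteNormedModule C_AbsRing} {D : Z -> Prop} {T : Z -> Z}.
Hypothesis HT : linear_on Z D T.

Lemma domain_zero : D zero.
Proof. apply HT. Qed.
Lemma domain_plus x y : D x -> D y -> D (plus x y).
Proof. apply HT. Qed.
Lemma domain_scal (a : C) x : D x -> D (scal a x).
Proof. apply HT. Qed.
Lemma linear_on_plus x y : D x -> D y -> T (plus x y) = plus (T x) (T y).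
Proof. apply HT. Qed.
Lemma linear_on_scal (a : C) x : D x -> T (scal a x) = scal a (T x).
Proof. apply HT. Qed.

Lemma minus_scal (x y : Z) : minus x y = plus x (scal (Copp (RtoC 1)) y).
Proof.
  unfold minus. f_equal. symmetry.
  exact (scal_opp_one (V := CompleteNormedModule.ModuleSpace C_AbsRing Z) y).
Qed.

Lemma domain_minus x y : D x -> D y -> D (minus x y).
Proof. intros Hx Hy. rewrite minus_scal. apply domain_plus, domain_scal; assumption. Qed.

Lemma linear_on_minus x y : D x -> D y -> T (minus x y) = minus (T x) (T y).
Proof.
  intros Hx Hy. rewrite !minus_scal, linear_on_plus, linear_on_scal; auto using domain_scal.
Qed.

End Linear.

Section Shift.
Context {Z : CompleteNormedModule C_AbsRing} {D : Z -> Prop} {T : Z -> Z}.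
Hypothesis HT : linear_on Z D T.
Context {ip : Z -> Z -> C}.
Hypothesis Hip : is_inner_product Z ip.

Lemma linear_on_shift (z : C) : linear_on Z D (fun x => plus (T x) (scal z x)).
Proof.
  split; [apply HT|]. split.
  - intros x y Hx Hy. rewrite (linear_on_plus HT) by assumption. vec Hip.
  - intros a x Hx. rewrite (linear_on_scal HT) by assumption. vec Hip.
Qed.

(* A zero of [T + P - y] is [T^-1] applied to a fixed point of the contraction [w |-> y - P (T^-1 w)]. *)
Lemma onto_perturbation (P : Z -> Z) (q : R) : linear_on Z D P -> 0 <= q < 1 ->
  (forall y, exists x, D x /\ T x = y) ->
  (forall x, D x -> norm (P x) <= q * norm (T x)) ->
  forall y, exists x, D x /\ plus (T x) (P x) = y.
Proof.
  intros HP Hq Honto Hb y. destruct (choice _ Honto) as [R0 HR].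
  destruct (banach_fixed_point (fun w => minus y (P (R0 w))) q Hq) as [w Hw].
  - intros w1 w2. destruct (HR w1) as [D1 E1], (HR w2) as [D2 E2].
    assert (E : minus (minus y (P (R0 w1))) (minus y (P (R0 w2))) = P (minus (R0 w2) (R0 w1))).
    { rewrite (linear_on_minus HP) by assumption.
      vec Hip. }
    rewrite E. eapply Rle_trans; [apply Hb; apply (domain_minus HT); assumption|].
    rewrite (linear_on_minus HT), E1, E2, norm_minus_sym by assumption. lra.
  - exists (R0 w). destruct (HR w) as [D1 E1]. split; [assumption|].
    rewrite E1. transitivity (plus (minus y (P (R0 w))) (P (R0 w))); [f_equal; symmetry; exact Hw|]. vec Hip.
Qed.
End Shift.

(** * Surjectivity of coercive self-adjoint operators *)

Section SelfAdjoint.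
Context {Z : CompleteNormedModule C_AbsRing} {ip : Z -> Z -> C}.
Hypothesis Hip : is_inner_product Z ip.

(** First-order condition at a minimum: with [m = |<y|w>|], the step [k = - s conj <y|w>],
    [s = 1 / (|w|^2 + 1)], changes [|y|^2] by at most [- s m^2], so [m = 0]. The [+ 1] keeps [s]
    defined when [w] is zero. *)
Lemma ip_zero_of_minimal (y w : Z) :
  (forall k : C, norm y <= norm (plus y (scal k w))) -> ip y w = RtoC 0.
Proof.
  intros H. apply Cmod_eq_0. set (m := Cmod (ip y w)). set (s := / (norm w ^ 2 + 1)).
  assert (Hw := pow2_ge_0 (norm w)). assert (Hm : 0 <= m) by apply Cmod_ge_0.
  assert (Hs : 0 < s) by (apply Rinv_0_lt_compat; lra).
  assert (Es : s * (norm w ^ 2 + 1) = 1) by (unfold s; apply Rinv_l; lra).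
  set (k := Cmult (RtoC (- s)) (Cconj (ip y w))). specialize (H k).
  assert (H2 : norm y ^ 2 <= norm (plus y (scal k w)) ^ 2).
  { apply pow_incr. split; [apply norm_ge_0|assumption]. }
  rewrite (norm_plus_sqr Hip), norm_scal_C, (ip_scal_r Hip) in H2.
  assert (E1 : Re (k * ip y w)%C = - s * m ^ 2).
  { unfold k, m, Cmod. rewrite pow2_sqrt by nra. unfold RtoC, Cconj, Cmult, Re; simpl. ring. }
  assert (E2 : Cmod k = s * m).
  { unfold k. rewrite Cmod_mult, Cmod_R, Cmod_conj, Rabs_Ropp, Rabs_pos_eq by lra. reflexivity. }
  rewrite E1, E2 in H2.
  replace ((s * m * norm w) ^ 2) with (s * m ^ 2 * (s * (norm w ^ 2 + 1) - s)) in H2 by ring.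
  rewrite Es in H2. fold m. destruct (Req_dec m 0) as [E0|N0]; [exact E0|exfalso].
  assert (0 < s * m ^ 2) by (apply Rmult_lt_0_compat; [lra|nra]). nra.
Qed.

(** Continuity of the inner product, in the form that replaces closedness of [T]: the relation
    [<u_n|T z> = <T u_n|z>] passes to the limit, and self-adjointness then puts the limit into the
    domain. *)
Lemma ip_limits_eq u v x y w z : converges u x -> converges v y ->
  (forall n : nat, ip (u n) w = ip (v n) z) -> ip x w = ip y z.
Proof.
  intros Hu Hv Huv. set (k := norm w + norm z + 1).
  pose proof (norm_ge_0 w). pose proof (norm_ge_0 z).
  assert (E : Cmod (ip x w - ip y z) <= 0).
  { apply le_epsilon. intros e He. rewrite Rplus_0_l.
    assert (He' : 0 < e / k) by (apply Rdiv_lt_0_compat; unfold k; lra).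
    destruct (Hu _ He') as [N1 HN1]. destruct (Hv _ He') as [N2 HN2].
    specialize (HN1 (N1 + N2)%nat ltac:(lia)). specialize (HN2 (N1 + N2)%nat ltac:(lia)).
    specialize (Huv (N1 + N2)%nat). set (n := (N1 + N2)%nat) in *.
    replace (ip x w - ip y z)%C with (ip (minus x (u n)) w + ip (minus (v n) y) z)%C.
    2: { rewrite !(ip_minus_l Hip), Huv. ring. }
    eapply Rle_trans; [apply Cmod_triangle|].
    pose proof (Cmod_ip_le Hip (minus x (u n)) w). pose proof (Cmod_ip_le Hip (minus (v n) y) z).
    rewrite norm_minus_sym in HN1.
    assert (Ek : e = e / k * norm w + e / k * norm z + e / k) by (unfold k; field; lra).
    assert (norm (minus x (u n)) * norm w <= e / k * norm w) by (apply Rmult_le_compat_r; lra).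
    assert (norm (minus (v n) y) * norm z <= e / k * norm z) by (apply Rmult_le_compat_r; lra).
    lra. }
  pose proof (Cmod_ge_0 (ip x w - ip y z)).
  assert (E0 : (ip x w - ip y z)%C = RtoC 0) by (apply Cmod_eq_0; lra).
  replace (ip x w) with ((ip x w - ip y z) + ip y z)%C by ring. rewrite E0. ring.
Qed.

(** For [y] in [D] near [x], [|x|^2 = <x|x - y> <= |x| |x - y|]. *)
Lemma dense_orthogonal_zero (D : Z -> Prop) (x : Z) :
  densely_defined Z D -> (forall z, D z -> ip x z = RtoC 0) -> x = zero.
Proof.
  intros HD Hx. apply (norm_eq_zero (x : Z)). apply Rle_antisym; [|apply norm_ge_0].
  apply le_epsilon. intros e He. rewrite Rplus_0_l. destruct (HD x e He) as [y [Hy Hn]].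
  apply Rle_trans with (norm (minus x y)); [|lra].
  rewrite <- (Rmult_1_l (norm x)). apply (norm_le_lower_bound Hip).
  rewrite (ip_minus_r Hip), (Hx y Hy), <- (Re_ip_self Hip). unfold Cminus, Cplus, Copp, Re; simpl. lra.
Qed.

(** A real [k] is its own conjugate, so the witness of membership in the adjoint domain is merely
    corrected by [k y]. *)
Lemma self_adjoint_shift (D : Z -> Prop) (T : Z -> Z) (k : R) :
  self_adjoint Z ip D T -> self_adjoint Z ip D (fun x => plus (T x) (scal (RtoC k) x)).
Proof.
  intros [Hadj Hsym].
  assert (Hk : forall x y, ip (scal (RtoC k) y) x = (RtoC k * ip y x)%C).
  { intros x y. rewrite (ip_scal_l Hip). f_equal. unfold Cconj, RtoC; simpl. f_equal. ring. }
  split.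
  - intros y. split.
    + intros Hy. exists (plus (T y) (scal (RtoC k) y)). intros x Hx.
      rewrite (ip_plus_l Hip), (ip_plus_r Hip), (ip_scal_r Hip), Hk, (Hsym x y Hx Hy). reflexivity.
    + intros [w Hw]. apply Hadj. exists (minus w (scal (RtoC k) y)). intros x Hx.
      rewrite (ip_minus_l Hip), Hk, <- (Hw x Hx). ip_simpl Hip. ring.
  - intros x y Hx Hy. rewrite (ip_plus_l Hip), (ip_plus_r Hip), (ip_scal_r Hip), Hk, (Hsym x y Hx Hy).
    reflexivity.
Qed.

Variables (D : Z -> Prop) (T : Z -> Z) (eps : R).
Hypothesis HT : linear_on Z D T.
Hypothesis HD : densely_defined Z D.
Hypothesis Hsa : self_adjoint Z ip D T.
Hypothesis Heps : 0 < eps.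
Hypothesis Hpos : forall x, D x -> eps * norm x ^ 2 <= Re (ip x (T x)).

(* [f] is approximated by [T x_n] minimising [|T x_n - f|]: the parallelogram law makes [T x_n]
   Cauchy, coercivity makes [x_n] Cauchy, and the residual is orthogonal to the range of [T],
   hence lies in [D] and is killed by [T]. *)
Lemma self_adjoint_coercive_onto f : exists x, D x /\ T x = f.
Proof.
  destruct Hsa as [Hadj Hsym].
  (* [E] collects the negated distances: its supremum [m0] gives the infimum [m = - m0]. *)
  set (E := fun r => exists x, D x /\ r = - norm (minus (T x) f)).
  destruct (completeness E) as [m0 [Hub Hlub]].
  { exists 0. intros r [x [_ ->]]. pose proof (norm_ge_0 (minus (T x) f)). lra. }
  { exists (- norm (minus (T zero) f)), zero. split; [apply (domain_zero HT)|reflexivity]. }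
  set (m := - m0).
  assert (Hm : forall x, D x -> m <= norm (minus (T x) f)).
  { intros x Hx. specialize (Hub (- norm (minus (T x) f))). unfold m.
    assert (- norm (minus (T x) f) <= m0) by (apply Hub; exists x; auto). lra. }
  assert (Hm0 : 0 <= m).
  { assert (m0 <= 0); [|unfold m; lra]. apply Hlub. intros r [x [_ ->]].
    pose proof (norm_ge_0 (minus (T x) f)). lra. }
  assert (Hex : forall n : nat, exists x, D x /\ norm (minus (T x) f) ^ 2 < m ^ 2 + / (INR n + 1)).
  { intros n. apply NNPP. intros Hno. assert (Hn : 0 < / (INR n + 1)).
    { apply Rinv_0_lt_compat. pose proof (pos_INR n). lra. }
    set (r := sqrt (m ^ 2 + / (INR n + 1))).
    assert (Er : r ^ 2 = m ^ 2 + / (INR n + 1)) by (apply pow2_sqrt; nra).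
    assert (Hr : 0 <= r) by apply sqrt_pos.
    assert (m0 <= - r); [|assert (m >= r) by (unfold m; lra); nra].
    apply Hlub. intros s [x [Hx ->]]. pose proof (norm_ge_0 (minus (T x) f)).
    destruct (Rlt_le_dec (norm (minus (T x) f)) r) as [Hl|Hl]; [|lra].
    exfalso. apply Hno. exists x. split; [assumption|]. rewrite <- Er. nra. }
  destruct (choice _ Hex) as [u Hu]. clear Hex Hub Hlub.
  assert (Hpar : forall n k, norm (minus (T (u n)) (T (u k))) ^ 2 <= 2 * (/ (INR n + 1) + / (INR k + 1))).
  { intros n k. destruct (Hu n) as [Dn Hn], (Hu k) as [Dk Hk].
    set (x := minus (T (u n)) f) in *. set (y := minus (T (u k)) f) in *.
    assert (E1 : minus (T (u n)) (T (u k)) = plus x (scal (RtoC (-1)) y)).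
    { unfold x, y. vec Hip. }
    assert (E2 : plus x y = scal (RtoC 2) (minus (T (scal (RtoC (/ 2)) (plus (u n) (u k)))) f)).
    { rewrite (linear_on_scal HT), (linear_on_plus HT) by auto using (domain_plus HT).
      unfold x, y. vec Hip. rewrite RtoC_inv by lra. field. }
    (* The midpoint of [u n] and [u k] lies in [D], so it is a competitor too, and its residual is
       [(x + y) / 2]. *)
    assert (H4 : 4 * m ^ 2 <= norm (plus x y) ^ 2).
    { rewrite E2, norm_scal_C, Cmod_R, Rabs_pos_eq by lra.
      specialize (Hm _ (domain_scal HT (RtoC (/ 2)) _ (domain_plus HT _ _ Dn Dk))). nra. }
    rewrite (norm_plus_sqr Hip) in H4.
    rewrite E1, (norm_plus_sqr Hip), norm_scal_C, Cmod_R, (ip_scal_r Hip), re_scal_l.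
    rewrite Rabs_left by lra. nra. }
  assert (Hcau : forall e, 0 < e -> exists N, forall n k, (N <= n)%nat -> (N <= k)%nat ->
     norm (minus (T (u n)) (T (u k))) < e).
  { intros e He. destruct (archimed_cor1 (e ^ 2 / 4)) as [N [HN HN0]]; [nra|].
    exists N. intros n k Hn Hk. specialize (Hpar n k).
    assert (Hle : forall j, (N <= j)%nat -> / (INR j + 1) <= / INR N).
    { intros j Hj. apply Rinv_le_contravar; [apply lt_0_INR; lia|]. apply le_INR in Hj. lra. }
    pose proof (Hle n Hn). pose proof (Hle k Hk). pose proof (norm_ge_0 (minus (T (u n)) (T (u k)))).
    apply Rnot_le_lt. intros Hc. assert (e ^ 2 <= norm (minus (T (u n)) (T (u k))) ^ 2) by (apply pow_incr; lra).
    lra. }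
  destruct (cauchy_converges (fun n => T (u n)) Hcau) as [h Hh].
  assert (Hbel : forall x, D x -> eps * norm x <= norm (T x)).
  { intros x Hx. apply (norm_le_lower_bound Hip), Hpos, Hx. }
  destruct (cauchy_converges u) as [x Hx].
  { intros e He. destruct (Hcau (eps * e)) as [N HN]; [nra|]. exists N. intros n k Hn Hk.
    specialize (HN n k Hn Hk). rewrite <- (linear_on_minus HT) in HN by (apply Hu).
    specialize (Hbel _ (domain_minus HT _ _ (proj1 (Hu n)) (proj1 (Hu k)))). nra. }
  (* At this stage [h] is only a limit of values of [T], so both sides are compared with [m]: the
     left one along [T (u n)], the right one along the competitors [u N + k z]. *)
  assert (Hle : forall z, D z -> forall k : C, norm (minus h f) <= norm (plus (minus h f) (scal k (T z)))).
  { intros z Hz k. apply Rle_trans with m.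
    - apply le_epsilon. intros e He.
      destruct (Hh (e / 2)) as [N1 HN1]; [lra|].
      destruct (archimed_cor1 (e ^ 2 / 4)) as [N [HN HN0]]; [nra|].
      specialize (HN1 (N1 + N)%nat ltac:(lia)). destruct (Hu (N1 + N)%nat) as [_ H2].
      assert (/ (INR (N1 + N) + 1) <= / INR N).
      { apply Rinv_le_contravar; [apply lt_0_INR; lia|]. rewrite plus_INR. pose proof (pos_INR N1). lra. }
      assert (norm (minus (T (u (N1 + N)%nat)) f) < m + e / 2).
      { apply Rnot_le_lt. intros Hc.
        assert ((m + e / 2) ^ 2 <= norm (minus (T (u (N1 + N)%nat)) f) ^ 2) by (apply pow_incr; lra). nra. }
      pose proof (norm_dist_triangle (T (u (N1 + N)%nat)) h f). rewrite (norm_minus_sym h (T _)) in H1. lra.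
    - apply le_epsilon. intros e He. destruct (Hh e He) as [N HN]. specialize (HN N (le_n N)).
      assert (Dk : D (plus (u N) (scal k z))).
      { apply (domain_plus HT); [apply Hu|]. apply (domain_scal HT), Hz. }
      specialize (Hm _ Dk). rewrite (linear_on_plus HT), (linear_on_scal HT) in Hm;
        [|assumption|apply Hu|apply (domain_scal HT), Hz].
      assert (E1 : minus (plus (T (u N)) (scal k (T z))) f
                   = plus (plus (minus h f) (scal k (T z))) (minus (T (u N)) h)) by vec Hip.
      rewrite E1 in Hm. pose proof (norm_triangle (plus (minus h f) (scal k (T z))) (minus (T (u N)) h)) as Ht.
      apply Rle_trans with (1 := Hm). apply Rle_trans with (1 := Ht). lra. }
  assert (Hort : forall z, D z -> ip (minus h f) (T z) = RtoC 0).
  { intros z Hz. apply ip_zero_of_minimal, Hle, Hz. }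
  assert (Dy : D (minus h f)).
  { apply Hadj. exists zero. intros z Hz. rewrite (Hort z Hz), (ip_zero_l Hip). reflexivity. }
  (* Taking [z = h - f] in the orthogonality relation, coercivity leaves [eps |h - f|^2 <= 0]. *)
  assert (Eh : h = f).
  { apply minus_eq_zero_eq. apply (ip_self_eq_zero Hip).
    specialize (Hpos _ Dy). rewrite (Hort _ Dy) in Hpos. rewrite (Re_ip_self Hip). simpl Re in Hpos. nra. }
  subst h.
  (* The limit of the symmetry relation says that [x] is in the domain of the adjoint with value
     [f]; density of [D] then identifies [T x] with [f]. *)
  assert (Hxz : forall z, D z -> ip x (T z) = ip f z).
  { intros z Hz. apply (ip_limits_eq u (fun n => T (u n))); try assumption.
    intros n. apply Hsym; [assumption|apply Hu]. }
  assert (Dx : D x) by (apply Hadj; exists f; assumption).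
  exists x. split; [assumption|]. apply minus_eq_zero_eq.
  apply (dense_orthogonal_zero D); [assumption|]. intros z Hz.
  rewrite (ip_minus_l Hip), <- (Hsym z x Hz Dx), (Hxz z Hz). ring.
Qed.
End SelfAdjoint.

(** * Contraction semigroups of maximal accretive operators *)

(** Telescoping: [P^n - Q^n] is a sum of [n] copies of [P - Q] flanked by powers of [P] and [Q].
    Commutation moves these powers to the outside, where contractivity removes them. All estimates
    on Euler approximations below are instances. *)
Lemma iter_dist_le {Z : CompleteNormedModule C_AbsRing} (P Q : Z -> Z) :
  (forall x y, norm (minus (P x) (P y)) <= norm (minus x y)) ->
  (forall x y, norm (minus (Q x) (Q y)) <= norm (minus x y)) ->
  (forall x, P (Q x) = Q (P x)) ->
  forall n x, norm (minus (Nat.iter n P x) (Nat.iter n Q x)) <= INR n * norm (minus (P x) (Q x)).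
Proof.
  intros HP HQ Hc n.
  assert (HPn : forall n x y, norm (minus (Nat.iter n P x) (Nat.iter n P y)) <= norm (minus x y)).
  { intros k x y. induction k as [|k IH]; simpl; [lra|]. apply Rle_trans with (1 := HP _ _), IH. }
  induction n as [|n IH]; intros x; [simpl; rewrite norm_minus_self; lra|].
  rewrite !Nat.iter_succ_r.
  pose proof (norm_dist_triangle (Nat.iter n P (Q x)) (Nat.iter n P (P x)) (Nat.iter n Q (Q x))).
  specialize (HPn n (P x) (Q x)). specialize (IH (Q x)). rewrite Hc in IH.
  specialize (HQ (P x) (Q x)). pose proof (pos_INR n). rewrite S_INR. nra.
Qed.

Lemma iter_comm_comp {T : Type} (P Q : T -> T) : (forall x, P (Q x) = Q (P x)) ->
  forall n x, Nat.iter n P (Nat.iter n Q x) = Nat.iter n (fun y => P (Q y)) x.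
Proof.
  intros Hc. assert (H : forall n x, P (Nat.iter n Q x) = Nat.iter n Q (P x)).
  { induction n as [|n IH]; intros x; simpl; [reflexivity|]. rewrite Hc, IH. reflexivity. }
  induction n as [|n IH]; intros x; [reflexivity|].
  rewrite !Nat.iter_succ_r, <- IH, H. reflexivity.
Qed.

(** * Right derivatives at zero and exponential rescaling *)

Section RightLimit.
Context {Z : CompleteNormedModule C_AbsRing} {ip : Z -> Z -> C}.
Hypothesis Hip : is_inner_product Z ip.

Definition right_limit (f : R -> Z) (l : Z) : Prop :=
  forall e, 0 < e -> exists d, 0 < d /\ forall t, 0 < t < d -> norm (minus (f t) l) < e.

Definition diff_quotient (T : R -> Z -> Z) (x : Z) (t : R) : Z :=
  scal (RtoC (/ t)) (minus (T t x) x).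

Lemma right_limit_ext f g l : (forall t, 0 < t -> f t = g t) -> right_limit f l -> right_limit g l.
Proof.
  intros H Hf e He. destruct (Hf e He) as [d [Hd Hl]]. exists d. split; [assumption|].
  intros t Ht. rewrite <- H by lra. apply Hl, Ht.
Qed.

Lemma right_limit_minus f g l m : right_limit f l -> right_limit g m ->
  right_limit (fun t => minus (f t) (g t)) (minus l m).
Proof.
  intros Hf Hg e He. destruct (Hf (e / 2)) as [d1 [Hd1 H1]]; [lra|].
  destruct (Hg (e / 2)) as [d2 [Hd2 H2]]; [lra|].
  exists (Rmin d1 d2). split; [apply Rmin_pos; assumption|]. intros t Ht.
  pose proof (Rmin_l d1 d2). pose proof (Rmin_r d1 d2).
  specialize (H1 t ltac:(lra)). specialize (H2 t ltac:(lra)).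
  replace (minus _ _) with (minus (minus (f t) l) (minus (g t) m)) by vec Hip.
  eapply Rle_lt_trans; [apply norm_minus_le|]. lra.
Qed.

Lemma exp_scale_diff (k e : R) : 0 < e -> exists d, 0 < d /\ forall t, 0 < t < d ->
  Rabs ((exp (k * t) - 1) / t - k) < e /\ Rabs (exp (k * t) - 1) < e.
Proof.
  intros He. assert (Hder : derivable_pt_lim (fun t => exp (k * t)) 0 k).
  { apply is_derive_Reals. auto_derive; [trivial|]. rewrite Rmult_0_r, exp_0. ring. }
  destruct (Hder (Rmin e 1)) as [d Hd]; [apply Rmin_pos; lra|].
  (* The tolerance is at most 1, so the quotient stays below [|k| + 1] in absolute value;
     [t < e / (|k| + 1)] then yields the second estimate from the first. *)
  exists (Rmin d (e / (Rabs k + 1))). pose proof (Rabs_pos k).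
  split; [apply Rmin_pos; [apply cond_pos|apply Rdiv_lt_0_compat; lra]|]. intros t [Ht0 Ht].
  pose proof (Rmin_l d (e / (Rabs k + 1))). pose proof (Rmin_r d (e / (Rabs k + 1))).
  specialize (Hd t ltac:(lra)). rewrite Rabs_pos_eq in Hd by lra. specialize (Hd ltac:(lra)).
  rewrite Rplus_0_l, Rmult_0_r, exp_0 in Hd. pose proof (Rmin_l e 1). pose proof (Rmin_r e 1).
  split; [lra|]. set (q := (exp (k * t) - 1) / t) in *.
  replace (exp (k * t) - 1) with (t * q) by (unfold q; field; lra).
  assert (Hq : Rabs q < Rabs k + 1).
  { replace q with ((q - k) + k) by ring. eapply Rle_lt_trans; [apply Rabs_triang|]. lra. }
  rewrite Rabs_mult, (Rabs_pos_eq t) by lra.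
  assert (Ht' : t < e / (Rabs k + 1)) by lra.
  apply (Rmult_lt_compat_r (Rabs k + 1)) in Ht'; [|lra].
  replace (e / (Rabs k + 1) * (Rabs k + 1)) with e in Ht' by (field; lra). nra.
Qed.

(** Product rule at [t = 0+]. It is used with [k = m] to pass from the contraction semigroup to the
    rescaled one and with [k = - m] to come back. *)
Lemma right_limit_diff_scale (T : R -> Z -> Z) (k : R) x l :
  right_limit (diff_quotient T x) l ->
  right_limit (diff_quotient (fun t y => scal (RtoC (exp (k * t))) (T t y)) x) (plus l (scal (RtoC k) x)).
Proof.
  intros Hl e He. pose proof (norm_ge_0 l) as Nl. pose proof (norm_ge_0 x) as Nx.
  destruct (Hl (e / 4)) as [d1 [Hd1 H1]]; [lra|].
  set (c := norm l + norm x + 1).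
  destruct (exp_scale_diff k (Rmin 1 (e / (2 * c)))) as [d2 [Hd2 H2]].
  { apply Rmin_pos; [lra|]. apply Rdiv_lt_0_compat; unfold c; lra. }
  exists (Rmin d1 d2). split; [apply Rmin_pos; assumption|]. intros t Ht.
  pose proof (Rmin_l d1 d2). pose proof (Rmin_r d1 d2).
  specialize (H1 t ltac:(lra)). specialize (H2 t ltac:(lra)). destruct H2 as [H2 H3].
  pose proof (Rmin_l 1 (e / (2 * c))) as Hm1. pose proof (Rmin_r 1 (e / (2 * c))) as Hm2.
  set (E := exp (k * t)) in *. set (q := diff_quotient T x t) in *.
  assert (Hdec : minus (diff_quotient (fun t y => scal (RtoC (exp (k * t))) (T t y)) x t)
                   (plus l (scal (RtoC k) x))
          = plus (scal (RtoC E) (minus q l))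
                 (plus (scal (RtoC (E - 1)) l) (scal (RtoC ((E - 1) / t - k)) x))).
  { unfold q, diff_quotient. fold E. vec Hip. unfold Rdiv.
    rewrite !RtoC_minus, RtoC_mult, RtoC_minus. ring. }
  rewrite Hdec. clear Hdec.
  eapply Rle_lt_trans; [exact (norm_triangle (scal (RtoC E) (minus q l)) _)|].
  eapply Rle_lt_trans; [apply Rplus_le_compat_l;
    exact (norm_triangle (scal (RtoC (E - 1)) l) (scal (RtoC ((E - 1) / t - k)) x))|].
  rewrite !norm_scal_C, !Cmod_R.
  assert (HE : Rabs E < 2).
  { replace E with ((E - 1) + 1) by ring. eapply Rle_lt_trans; [apply Rabs_triang|].
    rewrite (Rabs_pos_eq 1) by lra. lra. }
  assert (Rabs E * norm (minus q l) <= 2 * norm (minus q l)).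
  { apply Rmult_le_compat_r; [apply norm_ge_0|lra]. }
  assert (Rabs (E - 1) * norm l <= e / (2 * c) * norm l) by (apply Rmult_le_compat_r; lra).
  assert (Rabs ((E - 1) / t - k) * norm x <= e / (2 * c) * norm x) by (apply Rmult_le_compat_r; lra).
  assert (Ec : e / 2 = e / (2 * c) * norm l + e / (2 * c) * norm x + e / (2 * c)).
  { unfold c. field. lra. }
  assert (0 < e / (2 * c)) by (apply Rdiv_lt_0_compat; unfold c; lra). lra.
Qed.

End RightLimit.

(** * Resolvents, the dyadic Euler scheme and its limit *)

Section Semigroup.
Context {Z : CompleteNormedModule C_AbsRing} {ip : Z -> Z -> C}.
Hypothesis Hip : is_inner_product Z ip.
Variables (D : Z -> Prop) (G : Z -> Z).
Hypothesis HG : linear_on Z D G.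
Hypothesis HD : densely_defined Z D.
Hypothesis Hacc : forall x, D x -> 0 <= Re (ip x (G x)).
Hypothesis Honto : forall h : R, 0 < h -> forall y, exists x, D x /\ plus x (scal (RtoC h) (G x)) = y.

(* The resolvent [(1 + h G)^-1] for [h > 0], and the identity for [h <= 0]. *)
Definition implicit_step (h : R) (y : Z) : Z :=
  if Rle_dec h 0 then y
  else epsilon (inhabits zero) (fun x => D x /\ plus x (scal (RtoC h) (G x)) = y).
Local Notation J := implicit_step.

Lemma step_spec h y : 0 < h -> D (J h y) /\ plus (J h y) (scal (RtoC h) (G (J h y))) = y.
Proof.
  intros Hh. unfold implicit_step. destruct (Rle_dec h 0) as [Hn|_]; [lra|].
  apply (epsilon_spec (inhabits (zero : Z)) (fun x => D x /\ plus x (scal (RtoC h) (G x)) = y)).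
  apply Honto, Hh.
Qed.

Lemma step_0 y : J 0 y = y.
Proof. unfold implicit_step. destruct (Rle_dec 0 0); [reflexivity|lra]. Qed.

(** Accretivity gives [Re <x|x + h G x> >= |x|^2]. *)
Lemma norm_le_id_plus h x : 0 < h -> D x -> norm x <= norm (plus x (scal (RtoC h) (G x))).
Proof.
  intros Hh Hx. rewrite <- (Rmult_1_l (norm x)). apply (norm_le_lower_bound Hip).
  rewrite (ip_plus_r Hip), (ip_scal_r Hip). specialize (Hacc x Hx).
  assert (E := Re_ip_self Hip x). unfold Re in *. unfold Cplus, Cmult, RtoC; simpl fst. nra.
Qed.

(** Uniqueness in the resolvent equation, by [norm_le_id_plus] for the difference of two solutions.
    It makes the choice in [implicit_step] harmless, and the algebraic rules for [J] follow by
    exhibiting a solution. *)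
Lemma step_of_eq h x y : 0 < h -> D x -> plus x (scal (RtoC h) (G x)) = y -> J h y = x.
Proof.
  intros Hh Hx Ex. destruct (step_spec h y Hh) as [Dj Ej]. set (w := J h y) in *. apply norm_dist_zero_eq.
  apply Rle_trans with (1 := norm_le_id_plus h (minus w x) Hh (domain_minus HG _ _ Dj Hx)).
  rewrite (linear_on_minus HG) by assumption.
  replace (plus _ _) with (minus y y); [rewrite norm_minus_self; lra|].
  rewrite <- Ej at 1. rewrite <- Ex. vec Hip.
Qed.

Lemma step_contraction h y : 0 <= h -> norm (J h y) <= norm y.
Proof.
  intros [Hh|<-]; [|rewrite step_0; lra].
  destruct (step_spec h y Hh) as [Dj Ej]. rewrite <- Ej at 2. apply norm_le_id_plus; assumption.
Qed.

Lemma step_plus h x y : 0 <= h -> J h (plus x y) = plus (J h x) (J h y).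
Proof.
  intros [Hh|<-]; [|rewrite !step_0; reflexivity].
  destruct (step_spec h x Hh) as [D1 E1], (step_spec h y Hh) as [D2 E2].
  apply step_of_eq; [assumption|apply (domain_plus HG); assumption|].
  rewrite (linear_on_plus HG) by assumption. rewrite <- E1 at 3. rewrite <- E2 at 3. vec Hip.
Qed.

Lemma step_scal h (k : C) x : 0 <= h -> J h (scal k x) = scal k (J h x).
Proof.
  intros [Hh|<-]; [|rewrite !step_0; reflexivity].
  destruct (step_spec h x Hh) as [D1 E1].
  apply step_of_eq; [assumption|apply (domain_scal HG); assumption|].
  rewrite (linear_on_scal HG) by assumption. rewrite <- E1 at 3. vec Hip.
Qed.

Lemma step_minus h x y : 0 <= h -> J h (minus x y) = minus (J h x) (J h y).
Proof. intros Hh. rewrite !minus_scal, step_plus, step_scal by assumption. reflexivity. Qed.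

Lemma step_dist_le h x y : 0 <= h -> norm (minus (J h x) (J h y)) <= norm (minus x y).
Proof. intros Hh. rewrite <- step_minus by assumption. apply step_contraction, Hh. Qed.

Lemma step_domain h x : 0 <= h -> D x -> D (J h x).
Proof. intros [Hh|<-] Hx; [apply step_spec, Hh|rewrite step_0; exact Hx]. Qed.

(** The resolvent equation gives [G (J h x) = (x - J h x) / h], which lies in [D] when [x] does; so
    [G] can be applied to the equation once more. *)
Lemma step_G h x : 0 <= h -> D x -> G (J h x) = J h (G x).
Proof.
  intros [Hh|<-] Hx; [|rewrite !step_0; reflexivity].
  destruct (step_spec h x Hh) as [D1 E1].
  assert (E : G (J h x) = scal (RtoC (/ h)) (minus x (J h x))).
  { rewrite <- E1 at 2. vec Hip. rewrite RtoC_inv by lra. field. intros E0. apply RtoC_inj in E0. lra. }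
  assert (D2 : D (G (J h x))) by (rewrite E; apply (domain_scal HG), (domain_minus HG); assumption).
  symmetry. apply step_of_eq; [assumption|assumption|].
  rewrite <- (linear_on_scal HG), <- (linear_on_plus HG), E1; auto using (domain_scal HG).
Qed.

(** Applying [J h] to the equation for [J k x] and moving [J h] through [G] shows that [J h (J k x)]
    solves the equation of [J k (J h x)]. *)
Lemma step_comm h k x : 0 <= h -> 0 <= k -> J h (J k x) = J k (J h x).
Proof.
  intros Hh [Hk|<-]; [|rewrite !step_0; reflexivity].
  destruct (step_spec k x Hk) as [D1 E1].
  symmetry. apply step_of_eq; [assumption|apply step_domain; assumption|].
  rewrite step_G, <- step_scal, <- step_plus, E1 by assumption. reflexivity.
Qed.

(* [(1 + aG)(1 + bG) - (1 + (a + b)G) = ab G^2]. *)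
Lemma step_split_dist a b x : 0 <= a -> 0 <= b -> D x -> D (G x) ->
  norm (minus (J a (J b x)) (J (a + b) x)) <= a * b * norm (G (G x)).
Proof.
  intros Ha Hb Hx HGx.
  destruct Ha as [Ha|<-]; [|rewrite Rplus_0_l, step_0, norm_minus_self; lra].
  destruct Hb as [Hb|<-]; [|rewrite Rplus_0_r, step_0, norm_minus_self; lra].
  assert (Hab : 0 < a + b) by lra.
  set (v := J (a + b) x). set (w := J (a + b) (G (G x))).
  assert (Dv : D v) by (apply step_domain; [lra|assumption]).
  assert (Ev : G v = J (a + b) (G x)) by (apply step_G; [lra|assumption]).
  assert (DGv : D (G v)) by (rewrite Ev; apply step_domain; [lra|assumption]).
  assert (EGv : G (G v) = w) by (rewrite Ev; apply step_G; [lra|assumption]).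
  (* Since [(1 + (a + b) G) v = x] and [G^2 v = w], the operator identity reads
     [(1 + aG)(1 + bG) v = x + ab w]; both factors are then inverted. *)
  assert (E : J b (J a (plus x (scal (RtoC (a * b)) w))) = v).
  { apply step_of_eq; [assumption|assumption|]. symmetry. apply step_of_eq; [assumption| |].
    - apply (domain_plus HG), (domain_scal HG); assumption.
    - rewrite (linear_on_plus HG), (linear_on_scal HG), EGv by auto using (domain_scal HG).
      destruct (step_spec (a + b) x Hab) as [_ Ex]. fold v in Ex. rewrite <- Ex.
      vec Hip. rewrite RtoC_plus, RtoC_mult. ring. }
  rewrite !step_plus, !step_scal, (step_comm b a) in E by lra. rewrite <- E.
  replace (minus _ _) with (scal (RtoC (- (a * b))) (J b (J a w))) by (vec Hip; rewrite RtoC_opp; ring).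
  rewrite norm_scal_C, Cmod_R, Rabs_Ropp, Rabs_pos_eq by nra.
  apply Rmult_le_compat_l; [nra|]. apply Rle_trans with (1 := step_contraction b _ (Rlt_le _ _ Hb)).
  apply Rle_trans with (1 := step_contraction a _ (Rlt_le _ _ Ha)).
  apply step_contraction. lra.
Qed.

Lemma step_id_eq h x : 0 <= h -> D x -> minus (J h x) x = scal (RtoC (- h)) (J h (G x)).
Proof.
  intros Hh Hx. rewrite <- step_G by assumption. destruct Hh as [Hh|<-].
  - destruct (step_spec h x Hh) as [_ E]. rewrite <- E at 2. vec Hip. rewrite RtoC_opp. ring.
  - rewrite step_0. vec Hip. rewrite Ropp_0. ring.
Qed.

Lemma step_id_dist h x : 0 <= h -> D x -> norm (minus (J h x) x) <= h * norm (G x).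
Proof.
  intros Hh Hx. rewrite step_id_eq by assumption.
  rewrite norm_scal_C, Cmod_R, Rabs_Ropp, Rabs_pos_eq by assumption.
  apply Rmult_le_compat_l; [assumption|]. apply step_contraction, Hh.
Qed.

Lemma step_taylor h x : 0 <= h -> D x -> D (G x) ->
  norm (plus (minus (J h x) x) (scal (RtoC h) (G x))) <= h * h * norm (G (G x)).
Proof.
  intros Hh Hx HGx. rewrite step_id_eq by assumption.
  replace (plus _ _) with (scal (RtoC (- h)) (minus (J h (G x)) (G x))) by (vec Hip; rewrite RtoC_opp; ring).
  rewrite norm_scal_C, Cmod_R, Rabs_Ropp, Rabs_pos_eq, Rmult_assoc by assumption.
  apply Rmult_le_compat_l; [assumption|]. apply step_id_dist; assumption.
Qed.

Lemma step_strong x e : 0 < e -> exists d, 0 < d /\ forall h, 0 <= h < d -> norm (minus (J h x) x) < e.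
Proof.
  intros He. destruct (HD x (e / 3)) as [y [Hy Hxy]]; [lra|].
  exists (e / 3 / (norm (G y) + 1)). pose proof (norm_ge_0 (G y)) as Hn.
  split; [apply Rdiv_lt_0_compat; lra|]. intros h [Hh Hd].
  apply (Rmult_lt_compat_r (norm (G y) + 1)) in Hd; [|lra].
  replace (e / 3 / (norm (G y) + 1) * (norm (G y) + 1)) with (e / 3) in Hd by (field; lra).
  pose proof (step_dist_le h x y Hh). pose proof (step_id_dist h y Hh Hy).
  pose proof (norm_dist_triangle (J h y) (J h x) x). pose proof (norm_dist_triangle y (J h y) x).
  rewrite (norm_minus_sym y x) in H2. nra.
Qed.

(** [J h] maps [D] into the domain of [G^2] and tends strongly to the identity as [h] decreases to
    0. *)
Lemma core_dense x e : 0 < e -> exists y, D y /\ D (G y) /\ norm (minus y x) < e.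
Proof.
  intros He. destruct (HD x (e / 2)) as [y [Hy Hxy]]; [lra|].
  destruct (step_strong y (e / 2)) as [d [Hd Hs]]; [lra|].
  exists (J (d / 2) y). assert (0 <= d / 2) by lra. split; [apply step_domain; assumption|].
  split; [rewrite step_G by assumption; apply step_spec; lra|].
  specialize (Hs (d / 2) ltac:(lra)). pose proof (norm_dist_triangle y (J (d / 2) y) x).
  rewrite (norm_minus_sym y x) in H0. lra.
Qed.

(** The points [J h x] lie in the domain of [G^2], and [G (J h x) = J h (G x)] tends to [G x]. *)
Lemma core_graph_dense x e : D x -> 0 < e ->
  exists y, D y /\ D (G y) /\ norm (minus (G y) (G x)) < e.
Proof.
  intros Hx He. destruct (step_strong (G x) e He) as [d [Hd Hs]].
  exists (J (d / 2) x). split; [apply step_domain; [lra|assumption]|].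
  rewrite step_G by (assumption || lra). split; [apply step_spec; lra|]. apply Hs. lra.
Qed.

(** Doubling the number of steps splits each step of length [2h] into two of length [h], which is
    exactly the situation of [step_split_dist] with [a = b = h]. *)
Definition euler (n : nat) (t : R) : Z -> Z := Nat.iter (2 ^ n) (J (t / 2 ^ n)).

Lemma pow2_pos n : 0 < 2 ^ n.
Proof. apply pow_lt. lra. Qed.

Lemma euler_h_pos n t : 0 <= t -> 0 <= t / 2 ^ n.
Proof. intros Ht. apply Rmult_le_pos; [assumption|]. apply Rlt_le, Rinv_0_lt_compat, pow2_pos. Qed.

Lemma iter_step_plus N h x y : 0 <= h ->
  Nat.iter N (J h) (plus x y) = plus (Nat.iter N (J h) x) (Nat.iter N (J h) y).
Proof. intros Hh. induction N as [|N IH]; simpl; [reflexivity|]. rewrite IH. apply step_plus, Hh. Qed.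

Lemma iter_step_scal N h (k : C) x : 0 <= h ->
  Nat.iter N (J h) (scal k x) = scal k (Nat.iter N (J h) x).
Proof. intros Hh. induction N as [|N IH]; simpl; [reflexivity|]. rewrite IH. apply step_scal, Hh. Qed.

Lemma iter_step_contraction N h x : 0 <= h -> norm (Nat.iter N (J h) x) <= norm x.
Proof.
  intros Hh. induction N as [|N IH]; simpl; [lra|].
  apply Rle_trans with (1 := step_contraction h _ Hh), IH.
Qed.

Lemma euler_dist_le n t x y : 0 <= t -> norm (minus (euler n t x) (euler n t y)) <= norm (minus x y).
Proof.
  intros Ht. pose proof (euler_h_pos n t Ht) as Hh. unfold euler.
  rewrite (minus_scal (Nat.iter _ _ x)), <- iter_step_scal, <- iter_step_plus, <- minus_scal by assumption.
  apply iter_step_contraction, Hh.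
Qed.

(** There are [2^n] blocks, each with splitting error [h^2 |G^2 x|] for [h = t / 2^(n+1)]. *)
Lemma euler_refine n t x : 0 <= t -> D x -> D (G x) ->
  norm (minus (euler (S n) t x) (euler n t x)) <= t * t / 4 * (/ 2 ^ n) * norm (G (G x)).
Proof.
  intros Ht Hx HGx. unfold euler. set (h := t / 2 ^ S n). pose proof (pow2_pos n) as Hp.
  assert (Hh : 0 <= h) by (apply euler_h_pos, Ht).
  assert (E : t / 2 ^ n = h + h) by (unfold h; simpl; field; lra). rewrite E.
  assert (E2 : forall y, Nat.iter (2 ^ S n) (J h) y = Nat.iter (2 ^ n) (fun y => J h (J h y)) y).
  { intros y. rewrite <- (iter_comm_comp (J h) (J h)) by reflexivity. rewrite <- Nat.iter_add.
    f_equal. simpl. lia. }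
  rewrite E2. eapply Rle_trans; [apply iter_dist_le|].
  - intros y z. apply Rle_trans with (1 := step_dist_le h _ _ Hh), step_dist_le, Hh.
  - intros y z. apply step_dist_le. lra.
  - intros y. rewrite (step_comm h (h + h)), (step_comm h (h + h)) by lra. reflexivity.
  - pose proof (step_split_dist h h x Hh Hh Hx HGx) as H.
    apply Rle_trans with (2 ^ n * (h * h * norm (G (G x)))).
    + rewrite pow_INR. apply Rmult_le_compat_l; [apply Rlt_le, pow2_pos|exact H].
    + apply Req_le. unfold h. simpl. field. lra.
Qed.

(** The right-hand side is the exact geometric sum of the bounds in [euler_refine], so the induction
    on [k] closes without loss. *)
Lemma euler_cauchy_core n k t x : 0 <= t -> D x -> D (G x) ->
  norm (minus (euler (k + n) t x) (euler n t x)) <= t * t / 2 * norm (G (G x)) * (/ 2 ^ n - / 2 ^ (k + n)).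
Proof.
  intros Ht Hx HGx. induction k as [|k IH].
  - simpl. rewrite norm_minus_self. lra.
  - pose proof (norm_dist_triangle (euler (k + n) t x) (euler (S k + n) t x) (euler n t x)).
    pose proof (euler_refine (k + n) t x Ht Hx HGx).
    change (S k + n)%nat with (S (k + n)) in *.
    replace (/ 2 ^ S (k + n)) with (/ 2 * / 2 ^ (k + n)) by (simpl; pose proof (pow2_pos (k + n)); field; lra).
    lra.
Qed.

(** The approximations are contractions, so the rate on the dense domain of [G^2] gives Cauchy
    sequences everywhere. *)
Lemma euler_converges t x : 0 <= t -> exists l, converges (fun n => euler n t x) l.
Proof.
  intros Ht. apply cauchy_converges. intros e He.
  destruct (core_dense x (e / 6)) as [y [Hy [HGy Hxy]]]; [lra|].
  set (c := t * t / 2 * norm (G (G y))).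
  assert (Hc : 0 <= c) by (unfold c; pose proof (norm_ge_0 (G (G y))); nra).
  destruct (pow_lt_1_zero (/ 2)) with (y := e / 6 / (c + 1)) as [N HN];
    [rewrite Rabs_pos_eq; lra|apply Rdiv_lt_0_compat; lra|].
  assert (Hb : forall n, (N <= n)%nat -> norm (minus (euler n t x) (euler N t y)) < e / 2).
  { intros n Hn. pose proof (euler_cauchy_core N (n - N) t y Ht Hy HGy) as H1.
    replace (n - N + N)%nat with n in H1 by lia. fold c in H1.
    specialize (HN N (le_n N)). rewrite pow_inv in HN.
    assert (0 < / 2 ^ N) by (apply Rinv_0_lt_compat, pow2_pos).
    assert (0 < / 2 ^ n) by (apply Rinv_0_lt_compat, pow2_pos).
    rewrite Rabs_pos_eq in HN by lra. apply (Rmult_lt_compat_r (c + 1)) in HN; [|lra].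
    replace (e / 6 / (c + 1) * (c + 1)) with (e / 6) in HN by (field; lra).
    pose proof (norm_dist_triangle (euler n t y) (euler n t x) (euler N t y)).
    pose proof (euler_dist_le n t x y Ht). rewrite (norm_minus_sym x y) in H3. nra. }
  exists N. intros n m Hn Hm. pose proof (Hb n Hn) as H1. pose proof (Hb m Hm) as H2.
  rewrite norm_minus_sym in H2. pose proof (norm_dist_triangle (euler N t y) (euler n t x) (euler m t x)). lra.
Qed.

Definition contraction_semigroup (t : R) (x : Z) : Z :=
  epsilon (inhabits zero) (fun l => converges (fun n => euler n t x) l).
Local Notation U := contraction_semigroup.

Lemma semigroup_lim t x : 0 <= t -> converges (fun n => euler n t x) (U t x).
Proof. intros Ht. apply (epsilon_spec (inhabits (zero : Z)) (fun l => converges (fun n => euler n t x) l)).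
  apply euler_converges, Ht. Qed.

Lemma semigroup_contraction t x : 0 <= t -> norm (U t x) <= norm x.
Proof.
  intros Ht. apply (converges_le _ _ _ (semigroup_lim t x Ht)).
  intros n. apply iter_step_contraction, euler_h_pos, Ht.
Qed.

Lemma semigroup_plus t x y : 0 <= t -> U t (plus x y) = plus (U t x) (U t y).
Proof.
  intros Ht. apply (converges_unique _ _ _ (semigroup_lim t (plus x y) Ht)).
  intros e He. destruct (semigroup_lim t x Ht (e / 2)) as [N1 H1]; [lra|].
  destruct (semigroup_lim t y Ht (e / 2)) as [N2 H2]; [lra|].
  exists (N1 + N2)%nat. intros n Hn. specialize (H1 n ltac:(lia)). specialize (H2 n ltac:(lia)).
  unfold euler at 1. rewrite iter_step_plus by (apply euler_h_pos, Ht).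
  fold (euler n t). set (u := euler n t x) in *. set (v := euler n t y) in *.
  replace (minus _ _) with (plus (minus u (U t x)) (minus v (U t y))) by vec Hip.
  eapply Rle_lt_trans; [exact (norm_triangle (minus u (U t x)) (minus v (U t y)))|]. lra.
Qed.

Lemma semigroup_scal t (k : C) x : 0 <= t -> U t (scal k x) = scal k (U t x).
Proof.
  intros Ht. apply (converges_unique _ _ _ (semigroup_lim t (scal k x) Ht)).
  apply (converges_of_lipschitz_image (fun n => euler n t x) _ (Cmod k) (U t x)); [|apply semigroup_lim, Ht].
  intros n. unfold euler at 1. rewrite iter_step_scal by (apply euler_h_pos, Ht).
  fold (euler n t). set (u := euler n t x).
  replace (minus _ _) with (scal k (minus u (U t x))) by vec Hip. rewrite norm_scal_C. lra.
Qed.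

Lemma semigroup_minus t x y : 0 <= t -> U t (minus x y) = minus (U t x) (U t y).
Proof. intros Ht. rewrite !minus_scal, semigroup_plus, semigroup_scal by assumption. reflexivity. Qed.

Lemma semigroup_dist_le t x y : 0 <= t -> norm (minus (U t x) (U t y)) <= norm (minus x y).
Proof. intros Ht. rewrite <- semigroup_minus by assumption. apply semigroup_contraction, Ht. Qed.

Lemma semigroup_id_dist t x : 0 <= t -> D x -> norm (minus (U t x) x) <= t * norm (G x).
Proof.
  intros Ht Hx. apply (converges_dist_le _ _ _ _ (semigroup_lim t x Ht)). intros n.
  pose proof (euler_h_pos n t Ht) as Hh.
  (* The identity is written as an iterate, so that [iter_dist_le] compares it with [J] step by
     step; each of the [2^n] steps costs at most [(t / 2^n) |G x|]. *)
  assert (Hid : forall N (y : Z), Nat.iter N (fun z => z) y = y).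
  { induction N as [|N IH]; intros y; simpl; auto. }
  rewrite <- (Hid (2 ^ n)%nat x) at 2. eapply Rle_trans; [apply iter_dist_le|].
  - intros y z. apply step_dist_le, Hh.
  - intros y z. lra.
  - reflexivity.
  - apply Rle_trans with (2 ^ n * (t / 2 ^ n * norm (G x))).
    + rewrite pow_INR. apply Rmult_le_compat_l; [apply Rlt_le, pow2_pos|]. apply step_id_dist; assumption.
    + apply Req_le. field. pose proof (pow2_pos n). lra.
Qed.

(** Euler approximation number 0 is the single step [J t]. It is within [t^2 |G^2 x|] of the limit
    by the geometric sum, and within the same bound of [x - t G x] by [step_taylor]. *)
Lemma semigroup_taylor t x : 0 <= t -> D x -> D (G x) ->
  norm (plus (minus (U t x) x) (scal (RtoC t) (G x))) <= 2 * (t * t) * norm (G (G x)).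
Proof.
  intros Ht Hx HGx.
  assert (H1 : norm (minus (U t x) (J t x)) <= t * t * norm (G (G x))).
  { apply (converges_dist_le _ _ _ _ (semigroup_lim t x Ht)). intros n.
    pose proof (euler_cauchy_core 0 n t x Ht Hx HGx) as H. rewrite Nat.add_0_r in H.
    assert (E : euler 0 t x = J t x) by (unfold euler; simpl; f_equal; field). rewrite E in H.
    assert (0 < / 2 ^ n) by (apply Rinv_0_lt_compat, pow2_pos).
    assert (0 <= t * t * norm (G (G x))) by (apply Rmult_le_pos; [nra|apply norm_ge_0]).
    rewrite pow_O, Rinv_1 in H. nra. }
  pose proof (step_taylor t x Ht Hx HGx) as H2.
  replace (plus (minus (U t x) x) (scal (RtoC t) (G x))) with
    (plus (minus (U t x) (J t x)) (plus (minus (J t x) x) (scal (RtoC t) (G x)))) by vec Hip.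
  eapply Rle_trans;
    [exact (norm_triangle (minus (U t x) (J t x)) (plus (minus (J t x) x) (scal (RtoC t) (G x))))|]. lra.
Qed.

Lemma semigroup_0 x : U 0 x = x.
Proof.
  apply (converges_unique _ _ _ (semigroup_lim 0 x (Rle_refl 0))). intros e He. exists 0%nat. intros n _.
  assert (E : forall N y, Nat.iter N (J (0 / 2 ^ n)) y = y).
  { replace (0 / 2 ^ n) with 0 by (unfold Rdiv; ring).
    induction N as [|N IH]; intros y; simpl; [reflexivity|]. rewrite IH. apply step_0. }
  unfold euler. rewrite E, norm_minus_self. exact He.
Qed.

(** Both sides are limits of [euler n s (euler n t x)]. Its distance to [euler n (s + t) x] is at
    most [2^n] splitting errors [(s / 2^n) (t / 2^n) |G^2 x|], which tends to 0. *)
Lemma semigroup_add_core s t x : 0 <= s -> 0 <= t -> D x -> D (G x) -> U (s + t) x = U s (U t x).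
Proof.
  intros Hs Ht Hx HGx. assert (Hst : 0 <= s + t) by lra.
  apply (converges_unique (fun n => euler n s (euler n t x))).
  - intros e He. destruct (semigroup_lim (s + t) x Hst (e / 2)) as [N1 H1]; [lra|].
    set (c := s * t * norm (G (G x))).
    assert (Hc : 0 <= c) by (unfold c; pose proof (norm_ge_0 (G (G x))); apply Rmult_le_pos; nra).
    destruct (pow_lt_1_zero (/ 2)) with (y := e / 2 / (c + 1)) as [N2 HN2];
      [rewrite Rabs_pos_eq; lra|apply Rdiv_lt_0_compat; lra|].
    exists (N1 + N2)%nat. intros n Hn. specialize (H1 n ltac:(lia)). specialize (HN2 n ltac:(lia)).
    pose proof (pow2_pos n) as Hp.
    pose proof (euler_h_pos n s Hs) as Hhs. pose proof (euler_h_pos n t Ht) as Hht.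
    assert (H2 : norm (minus (euler n s (euler n t x)) (euler n (s + t) x)) <= c * / 2 ^ n).
    { unfold euler. rewrite (iter_comm_comp (J (s / 2 ^ n)) (J (t / 2 ^ n))) by (intros; apply step_comm; assumption).
      replace ((s + t) / 2 ^ n) with (s / 2 ^ n + t / 2 ^ n) by (field; lra).
      eapply Rle_trans; [apply iter_dist_le|].
      - intros y z. apply Rle_trans with (1 := step_dist_le _ _ _ Hhs), step_dist_le, Hht.
      - intros y z. apply step_dist_le. lra.
      - intros y. rewrite (step_comm (t / 2 ^ n)), (step_comm (s / 2 ^ n)) by lra. reflexivity.
      - apply Rle_trans with (2 ^ n * (s / 2 ^ n * (t / 2 ^ n) * norm (G (G x)))).
        + rewrite pow_INR. apply Rmult_le_compat_l; [lra|]. apply step_split_dist; assumption.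
        + apply Req_le. unfold c. field. lra. }
    rewrite pow_inv, Rabs_pos_eq in HN2 by (apply Rlt_le, Rinv_0_lt_compat, Hp).
    apply (Rmult_lt_compat_r (c + 1)) in HN2; [|lra].
    replace (e / 2 / (c + 1) * (c + 1)) with (e / 2) in HN2 by (field; lra).
    assert (0 < / 2 ^ n) by (apply Rinv_0_lt_compat, Hp).
    pose proof (norm_dist_triangle (euler n (s + t) x) (euler n s (euler n t x)) (U (s + t) x)). nra.
  - intros e He. destruct (semigroup_lim t x Ht (e / 2)) as [N1 H1]; [lra|].
    destruct (semigroup_lim s (U t x) Hs (e / 2)) as [N2 H2]; [lra|].
    exists (N1 + N2)%nat. intros n Hn. specialize (H1 n ltac:(lia)). specialize (H2 n ltac:(lia)).
    pose proof (norm_dist_triangle (euler n s (U t x)) (euler n s (euler n t x)) (U s (U t x))).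
    pose proof (euler_dist_le n s (euler n t x) (U t x) Hs). lra.
Qed.

Lemma semigroup_add s t x : 0 <= s -> 0 <= t -> U (s + t) x = U s (U t x).
Proof.
  intros Hs Ht. apply (norm_dist_lt_all_eq _ _ 2). intros e He.
  destruct (core_dense x e He) as [y [Hy [HGy Hxy]]].
  pose proof (norm_dist_triangle (U (s + t) y) (U (s + t) x) (U s (U t x))) as H1.
  rewrite (semigroup_add_core s t y) in H1 at 2 by assumption.
  pose proof (semigroup_dist_le (s + t) x y ltac:(lra)) as H2.
  pose proof (semigroup_dist_le s (U t y) (U t x) Hs) as H3.
  pose proof (semigroup_dist_le t y x Ht) as H4. rewrite (norm_minus_sym x y) in H2. lra.
Qed.

Lemma semigroup_strong x e : 0 < e ->
  exists d, 0 < d /\ forall t, 0 <= t < d -> norm (minus (U t x) x) < e.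
Proof.
  intros He. destruct (HD x (e / 3)) as [y [Hy Hxy]]; [lra|].
  exists (e / 3 / (norm (G y) + 1)). pose proof (norm_ge_0 (G y)) as Hn.
  split; [apply Rdiv_lt_0_compat; lra|]. intros h [Hh Hd].
  apply (Rmult_lt_compat_r (norm (G y) + 1)) in Hd; [|lra].
  replace (e / 3 / (norm (G y) + 1) * (norm (G y) + 1)) with (e / 3) in Hd by (field; lra).
  pose proof (semigroup_dist_le h x y Hh). pose proof (semigroup_id_dist h y Hh Hy).
  pose proof (norm_dist_triangle (U h y) (U h x) x). pose proof (norm_dist_triangle y (U h y) x).
  rewrite (norm_minus_sym y x) in H2. nra.
Qed.

(** The Taylor estimate holds only on the domain of [G^2], so [x] is split as [(x - y) + y] with [y]
    in that domain and [G y] near [G x]. On [x - y] the difference quotient is at most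
    [|G x - G y|], uniformly in [t]. *)
Lemma semigroup_generator x : D x -> right_limit (diff_quotient U x) (scal (RtoC (-1)) (G x)).
Proof.
  intros Hx e He. destruct (core_graph_dense x (e / 4) Hx) as [y [Hy [HGy Hxy]]]; [lra|].
  pose proof (norm_ge_0 (G (G y))) as Hn.
  exists (e / 2 / (2 * norm (G (G y)) + 1)). split; [apply Rdiv_lt_0_compat; lra|]. intros t [Ht0 Ht].
  apply (Rmult_lt_compat_r (2 * norm (G (G y)) + 1)) in Ht; [|lra].
  replace (e / 2 / (2 * norm (G (G y)) + 1) * (2 * norm (G (G y)) + 1)) with (e / 2) in Ht by (field; lra).
  assert (Ht1 : 0 <= t) by lra.
  pose proof (semigroup_id_dist t (minus x y) Ht1 (domain_minus HG _ _ Hx Hy)) as H1.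
  pose proof (semigroup_taylor t y Ht1 Hy HGy) as H2.
  rewrite (linear_on_minus HG), (norm_minus_sym (G x)) in H1 by assumption.
  set (p := minus (U t (minus x y)) (minus x y)) in *.
  set (r := plus (minus (U t y) y) (scal (RtoC t) (G y))) in *.
  assert (Hdec : minus (diff_quotient U x t) (scal (RtoC (-1)) (G x))
    = plus (scal (RtoC (/ t)) (plus p r)) (minus (G x) (G y))).
  { unfold p, r, diff_quotient. rewrite semigroup_minus by assumption. vec Hip.
    rewrite RtoC_inv by lra. field. intros E0. apply RtoC_inj in E0. lra. }
  rewrite Hdec. eapply Rle_lt_trans; [exact (norm_triangle (scal (RtoC (/ t)) (plus p r)) (minus (G x) (G y)))|].
  assert (Hti : 0 < / t) by (apply Rinv_0_lt_compat; lra).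
  rewrite norm_scal_C, Cmod_R, Rabs_pos_eq, (norm_minus_sym (G x)) by lra.
  assert (Hpr : norm (plus p r) <= norm p + norm r) by exact (norm_triangle p r).
  assert (/ t * norm (plus p r) <= norm (minus (G y) (G x)) + 2 * (t * norm (G (G y)))).
  { replace (norm (minus (G y) (G x)) + 2 * (t * norm (G (G y)))) with
      (/ t * (t * norm (minus (G y) (G x)) + 2 * (t * t) * norm (G (G y)))) by (field; lra).
    apply Rmult_le_compat_l; lra. }
  lra.
Qed.

(* [x - J_1 (x - l)] is an eigenvector of the right derivative for the eigenvalue [1], which a
   contraction semigroup does not allow. *)
Lemma semigroup_derivative_domain x l : right_limit (diff_quotient U x) l -> D x.
Proof.
  intros Hl. destruct (step_spec 1 (minus x l) Rlt_0_1) as [Dy Ey].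
  set (y := J 1 (minus x l)) in *. set (w := minus x y).
  (* As [y + G y = x - l], the right derivative at [w = x - y] is [l + G y = w]. *)
  assert (Hw : right_limit (diff_quotient U w) w).
  { assert (E : w = minus l (scal (RtoC (-1)) (G y))).
    { assert (Ex : x = plus l (plus y (scal (RtoC 1) (G y)))) by (rewrite Ey; vec Hip).
      unfold w. rewrite Ex at 1. vec Hip. }
    rewrite E at 2. apply (right_limit_ext (fun t => minus (diff_quotient U x t) (diff_quotient U y t))).
    - intros t Ht. unfold diff_quotient, w. rewrite semigroup_minus by lra. vec Hip.
    - apply (right_limit_minus Hip); [assumption|]. apply semigroup_generator, Dy. }
  assert (E : x = y); [|rewrite E; exact Dy].
  apply (norm_dist_lt_all_eq _ _ 1). intros e He. rewrite Rmult_1_l. fold w.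
  destruct (Hw e He) as [d [Hd H]]. specialize (H (d / 2) ltac:(lra)). set (t := d / 2) in *.
  assert (Ht : 0 < t) by (unfold t; lra).
  pose proof (semigroup_contraction t w (Rlt_le _ _ Ht)) as Hc.
  (* The quotient is within [e] of [w], so [(1 + t) |w| <= |U t w| + t e <= |w| + t e], that is
     [|w| <= e]. *)
  assert (Ed : scal (RtoC (1 + t)) w = minus (U t w) (scal (RtoC t) (minus (diff_quotient U w t) w))).
  { unfold diff_quotient. vec Hip. rewrite RtoC_inv, RtoC_plus by lra. field.
    intros E0. apply RtoC_inj in E0. lra. }
  assert (Hn := norm_minus_le (U t w) (scal (RtoC t) (minus (diff_quotient U w t) w))).
  rewrite <- Ed, !norm_scal_C, !Cmod_R, !Rabs_pos_eq in Hn by lra. nra.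
Qed.

End Semigroup.

(** * Generation for quasi-accretive operators *)

Section Generation.
Context {Z : CompleteNormedModule C_AbsRing} {ip : Z -> Z -> C}.
Hypothesis Hip : is_inner_product Z ip.
Variables (D : Z -> Prop) (G : Z -> Z).
Hypothesis HG : linear_on Z D G.

Definition accretive_shift (m : R) : Prop := forall x, D x -> - m * norm x ^ 2 <= Re (ip x (G x)).

Lemma accretive_shift_lower_bound m (z : C) x : accretive_shift m -> D x ->
  (Re z - m) * norm x <= norm (plus (G x) (scal z x)).
Proof.
  intros Hm Hx. apply (norm_le_lower_bound Hip).
  rewrite (ip_plus_r Hip), (ip_scal_r Hip), (ip_norm _ _ Hip). specialize (Hm x Hx).
  unfold Re in *. unfold Cplus, Cmult, RtoC; cbn [fst snd]. lra.
Qed.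

(* The discs [|z - L| < L] around large real [L] exhaust the right half plane. *)
Lemma accretive_onto m L0 : accretive_shift m ->
  (forall L, L0 < L -> forall y, exists x, D x /\ plus (G x) (scal (RtoC L) x) = y) ->
  forall z : C, m < Re z -> forall y, exists x, D x /\ plus (G x) (scal z x) = y.
Proof.
  intros Hm Hlarge z Hz y. set (r := Re z - m).
  set (w := (z - RtoC m)%C).
  (* With [r = Re w], [|w - M|^2 = |w|^2 - 2 r M + M^2] drops below [M^2] once [2 r M > |w|^2]. The
     other entries keep [M] positive and [M + m] above [L0]. *)
  set (M := Rmax 1 (Rmax (L0 - m + 1) (Cmod w ^ 2 / (2 * r) + 1))).
  assert (HM1 : 1 <= M) by apply Rmax_l.
  assert (HM2 : L0 - m + 1 <= M) by (eapply Rle_trans; [apply Rmax_l|apply Rmax_r]).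
  assert (HM3 : Cmod w ^ 2 / (2 * r) + 1 <= M) by (eapply Rle_trans; [apply Rmax_r|apply Rmax_r]).
  assert (Hr : 0 < r) by (unfold r; lra).
  assert (HM4 : Cmod w ^ 2 < 2 * r * M).
  { apply Rlt_le_trans with (2 * r * (Cmod w ^ 2 / (2 * r) + 1)); [|apply Rmult_le_compat_l; lra].
    replace (2 * r * (Cmod w ^ 2 / (2 * r) + 1)) with (Cmod w ^ 2 + 2 * r) by (field; lra). lra. }
  assert (Hlin : linear_on Z D (fun x => plus (G x) (scal (RtoC (M + m)) x))) by (apply (linear_on_shift HG Hip)).
  assert (Hdist : Cmod (w - RtoC M) < M).
  { assert (Hsq : Cmod (w - RtoC M) ^ 2 < M ^ 2).
    { assert (E : Cmod (w - RtoC M) ^ 2 = Cmod w ^ 2 - 2 * r * M + M ^ 2).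
      { unfold Cmod. rewrite !pow2_sqrt by nra. unfold r, w, Re. simpl. ring. }
      rewrite E. lra. }
    apply Rnot_le_lt. intros Hc. assert (M ^ 2 <= Cmod (w - RtoC M) ^ 2) by (apply pow_incr; lra). lra. }
  (* [G + (M + m)] is onto and bounded below by [M], so adding [w - M] is a perturbation of relative
     size [|w - M| / M < 1]; a single disc reaches [z]. *)
  destruct (onto_perturbation Hlin Hip (fun x => scal (w - RtoC M)%C x) (Cmod (w - RtoC M) / M)) with (y := y)
    as [x [Hx Ex]].
  - split; [apply HG|]. split; intros; vec Hip.
  - split; [apply Rmult_le_pos; [apply Cmod_ge_0|]; apply Rlt_le, Rinv_0_lt_compat; lra|].
    apply Rmult_lt_reg_r with M; [lra|]. unfold Rdiv. rewrite Rmult_assoc, Rinv_l by lra. lra.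
  - apply Hlarge. lra.
  - intros x Hx. rewrite norm_scal_C. unfold Rdiv. rewrite Rmult_assoc.
    apply Rmult_le_compat_l; [apply Cmod_ge_0|].
    pose proof (accretive_shift_lower_bound m (RtoC (M + m)) x Hm Hx) as H. rewrite re_RtoC in H.
    apply Rmult_le_reg_l with M; [lra|]. rewrite <- Rmult_assoc, Rinv_r, Rmult_1_l by lra.
    replace (M + m - m) with M in H by ring. exact H.
  - exists x. split; [assumption|]. rewrite <- Ex. unfold w. vec Hip. rewrite RtoC_plus. ring.
Qed.

Hypothesis HD : densely_defined Z D.

(** The admissible [m] are the upper bounds of [- Re <x|G x> / |x|^2] over nonzero [x] in [D].
    Density and a nonzero vector of [Z] supply one such [x], hence a lower bound; the infimum is
    itself admissible because the inequality is not strict. *)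
Lemma accretive_shift_optimal : (exists x : Z, x <> zero) -> (exists m, accretive_shift m) ->
  exists m0, accretive_shift m0 /\ forall m, accretive_shift m -> m0 <= m.
Proof.
  intros [x0 Hx0] [m1 Hm1].
  assert (Hnz : exists x, D x /\ 0 < norm x).
  { assert (H0 : 0 < norm x0) by (apply norm_gt_0; assumption).
    destruct (HD x0 (norm x0) H0) as [x [Hx Hn]]. exists x. split; [assumption|].
    destruct (Rle_lt_dec (norm x) 0) as [Hle|Hlt]; [exfalso|assumption].
    assert (E : x0 = plus (minus x0 x) x) by vec Hip.
    assert (norm x0 <= norm (minus x0 x) + norm x); [|lra].
    rewrite E at 1. exact (norm_triangle (minus x0 x) x). }
  destruct Hnz as [x [Hx Nx]].
  destruct (completeness (fun r => accretive_shift (- r))) as [s [Hub Hlub]].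
  - exists (Re (ip x (G x)) / norm x ^ 2). intros r Hr. specialize (Hr x Hx).
    assert (0 < norm x ^ 2) by nra. apply Rmult_le_reg_r with (norm x ^ 2); [assumption|].
    unfold Rdiv. rewrite Rmult_assoc, Rinv_l by lra. lra.
  - exists (- m1). rewrite Ropp_involutive. exact Hm1.
  - exists (- s). split.
    + intros y Hy. rewrite Ropp_involutive. destruct (Req_dec (norm y) 0) as [E|N].
      * assert (Ey : y = zero) by (apply (norm_eq_zero y); assumption).
        rewrite E, Ey, (ip_zero_l Hip). simpl. lra.
      * pose proof (norm_ge_0 y). assert (Hp : 0 < norm y ^ 2) by nra.
        assert (Hs : s <= Re (ip y (G y)) / norm y ^ 2).
        { apply Hlub. intros r Hr. specialize (Hr y Hy). apply Rmult_le_reg_r with (norm y ^ 2); [assumption|].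
          unfold Rdiv. rewrite Rmult_assoc, Rinv_l by lra. lra. }
        apply (Rmult_le_compat_r (norm y ^ 2)) in Hs; [|lra].
        unfold Rdiv in Hs. rewrite Rmult_assoc, Rinv_l in Hs by lra. lra.
    + intros m Hm. specialize (Hub (- m)). assert (- m <= s); [|lra].
      apply Hub. rewrite Ropp_involutive. exact Hm.
Qed.

(** The last two fields pin the generator down from both sides: the right derivative at 0 exists
    exactly on [D], and there it is [- G], in accordance with [T(t) = exp(-tG)]. *)
Record generates (m : R) (T : R -> Z -> Z) : Prop := {
  gen_plus : forall t x y, 0 <= t -> T t (plus x y) = plus (T t x) (T t y);
  gen_scal : forall t (k : C) x, 0 <= t -> T t (scal k x) = scal k (T t x);
  gen_bound : forall t x, 0 <= t -> norm (T t x) <= exp (m * t) * norm x;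
  gen_0 : forall x, T 0 x = x;
  gen_add : forall s t x, 0 <= s -> 0 <= t -> T (s + t) x = T s (T t x);
  gen_strong : forall x e, 0 < e ->
    exists d, 0 < d /\ forall t, 0 <= t < d -> norm (minus (T t x) x) < e;
  gen_derivative : forall x, D x -> right_limit (diff_quotient T x) (scal (RtoC (-1)) (G x));
  gen_domain : forall x l, right_limit (diff_quotient T x) l -> D x
}.

Lemma accretive_shift_generates m L0 : accretive_shift m ->
  (forall L, L0 < L -> forall y, exists x, D x /\ plus (G x) (scal (RtoC L) x) = y) ->
  exists T, generates m T.
Proof.
  intros Hm Hlarge. set (G' := fun x => plus (G x) (scal (RtoC m) x)).
  assert (HG' : linear_on Z D G') by (apply (linear_on_shift HG Hip)).
  assert (Hacc : forall x, D x -> 0 <= Re (ip x (G' x))).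
  { intros x Hx. unfold G'. rewrite (ip_plus_r Hip), (ip_scal_r Hip), (ip_norm _ _ Hip).
    specialize (Hm x Hx). unfold Re in *. unfold Cplus, Cmult, RtoC; cbn [fst snd]. lra. }
  assert (Honto : forall h, 0 < h -> forall y, exists x, D x /\ plus x (scal (RtoC h) (G' x)) = y).
  (* Division by [h] turns the equation into [(G + (m + 1/h)) x = y / h], and [m + 1/h] lies to the
     right of [m]. *)
  { intros h Hh y. assert (Hi : 0 < / h) by (apply Rinv_0_lt_compat; lra).
    destruct (accretive_onto m L0 Hm Hlarge (RtoC (m + / h))) with (y := scal (RtoC (/ h)) y) as [x [Hx Ex]].
    { rewrite re_RtoC. lra. }
    exists x. split; [assumption|].
    assert (Ey : y = scal (RtoC h) (scal (RtoC (/ h)) y)).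
    { vec Hip. rewrite RtoC_inv by lra. field. intros E0. apply RtoC_inj in E0. lra. }
    rewrite Ey, <- Ex. unfold G'. vec Hip. rewrite RtoC_plus, RtoC_inv by lra. field.
    intros E0. apply RtoC_inj in E0. lra. }
  set (U := contraction_semigroup D G').
  exists (fun t x => scal (RtoC (exp (m * t))) (U t x)). split.
  - intros t x y Ht. unfold U. rewrite (semigroup_plus Hip D G' HG' HD Hacc Honto) by assumption. vec Hip.
  - intros t k x Ht. unfold U. rewrite (semigroup_scal Hip D G' HG' HD Hacc Honto) by assumption. vec Hip.
  - intros t x Ht. rewrite norm_scal_C, Cmod_R, Rabs_pos_eq by (apply Rlt_le, exp_pos).
    apply Rmult_le_compat_l; [apply Rlt_le, exp_pos|].
    apply (semigroup_contraction Hip D G' HG' HD Hacc Honto), Ht.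
  - intros x. unfold U. rewrite (semigroup_0 Hip D G' HG' HD Hacc Honto), Rmult_0_r, exp_0. vec Hip.
  - intros s t x Hs Ht. unfold U. rewrite (semigroup_add Hip D G' HG' HD Hacc Honto) by assumption.
    rewrite (semigroup_scal Hip D G' HG' HD Hacc Honto) by assumption.
    rewrite Rmult_plus_distr_l, exp_plus, RtoC_mult. vec Hip.
  - intros x e He. destruct (semigroup_strong Hip D G' HG' HD Hacc Honto x (e / 4)) as [d1 [Hd1 H1]]; [lra|].
    pose proof (norm_ge_0 x) as Nx.
    destruct (exp_scale_diff m (Rmin 1 (e / 2 / (norm x + 1)))) as [d2 [Hd2 H2]].
    { apply Rmin_pos; [lra|]. apply Rdiv_lt_0_compat; lra. }
    exists (Rmin d1 d2). split; [apply Rmin_pos; assumption|]. intros t [Ht0 Ht].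
    pose proof (Rmin_l d1 d2). pose proof (Rmin_r d1 d2).
    assert (HE : Rabs (exp (m * t) - 1) < Rmin 1 (e / 2 / (norm x + 1))).
    { destruct Ht0 as [Ht0|<-]; [apply H2; lra|].
      rewrite Rmult_0_r, exp_0, Rminus_diag, Rabs_R0. apply Rmin_pos; [lra|]. apply Rdiv_lt_0_compat; lra. }
    specialize (H1 t ltac:(lra)). fold U in H1. set (E := exp (m * t)) in *.
    replace (minus _ _) with (plus (scal (RtoC E) (minus (U t x) x)) (scal (RtoC (E - 1)) x))
      by (vec Hip; rewrite RtoC_minus; ring).
    eapply Rle_lt_trans; [exact (norm_triangle (scal (RtoC E) (minus (U t x) x)) (scal (RtoC (E - 1)) x))|].
    rewrite !norm_scal_C, !Cmod_R.
    pose proof (Rmin_l 1 (e / 2 / (norm x + 1))). pose proof (Rmin_r 1 (e / 2 / (norm x + 1))).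
    assert (HE2 : Rabs E < 2).
    { replace E with ((E - 1) + 1) by ring. eapply Rle_lt_trans; [apply Rabs_triang|].
      rewrite (Rabs_pos_eq 1) by lra. lra. }
    assert (Rabs E * norm (minus (U t x) x) <= 2 * norm (minus (U t x) x)).
    { apply Rmult_le_compat_r; [apply norm_ge_0|lra]. }
    assert (Rabs (E - 1) * norm x <= e / 2 / (norm x + 1) * norm x) by (apply Rmult_le_compat_r; lra).
    assert (e / 2 / (norm x + 1) * norm x <= e / 2).
    { apply Rmult_le_reg_r with (norm x + 1); [lra|].
      replace (e / 2 / (norm x + 1) * norm x * (norm x + 1)) with (e / 2 * norm x) by (field; lra). nra. }
    lra.
  - intros x Hx.
    replace (scal (RtoC (-1)) (G x)) with (plus (scal (RtoC (-1)) (G' x)) (scal (RtoC m) x)).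
    2: { unfold G'. vec Hip. }
    apply (right_limit_diff_scale Hip), (semigroup_generator Hip D G' HG' HD Hacc Honto), Hx.
  (* Multiplying by [exp (- m t)] recovers the contraction semigroup, whose right derivative at [x]
     is then [l - m x]. *)
  - intros x l Hl. apply (semigroup_derivative_domain Hip D G' HG' HD Hacc Honto) with (plus l (scal (RtoC (- m)) x)).
    apply (right_limit_ext (diff_quotient
      (fun t y => scal (RtoC (exp (- m * t))) (scal (RtoC (exp (m * t))) (U t y))) x)).
    + intros t Ht. unfold diff_quotient. fold U. do 2 f_equal.
      assert (E : exp (- m * t) * exp (m * t) = 1).
      { rewrite <- exp_plus. replace (- m * t + m * t) with 0 by ring. apply exp_0. }
      transitivity (scal (RtoC (exp (- m * t) * exp (m * t))) (U t x)).
      * rewrite RtoC_mult. vec Hip.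
      * rewrite E. vec Hip.
    + apply (right_limit_diff_scale Hip (fun t y => scal (RtoC (exp (m * t))) (U t y)) (- m)), Hl.
Qed.

End Generation.

(** * The first-order wave operator *)

Lemma plus_pair {X : CompleteNormedModule C_AbsRing} (p q : X * X) :
  @plus (CompleteNormedModule.AbelianMonoid _ (prod_CompleteNormedModule C_AbsRing X X)) p q
  = (plus (fst p) (fst q), plus (snd p) (snd q)).
Proof. reflexivity. Qed.

Lemma scal_pair {X : CompleteNormedModule C_AbsRing} (k : C) (p : X * X) :
  @scal C_Ring (CompleteNormedModule.ModuleSpace _ (prod_CompleteNormedModule C_AbsRing X X)) k p
  = (scal k (fst p), scal k (snd p)).
Proof. reflexivity. Qed.

Lemma minus_pair {X : CompleteNormedModule C_AbsRing} (p q : X * X) :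
  @minus (CompleteNormedModule.AbelianGroup _ (prod_CompleteNormedModule C_AbsRing X X)) p q
  = (minus (fst p) (fst q), minus (snd p) (snd q)).
Proof. reflexivity. Qed.

Section Wave.
Context {X : CompleteNormedModule C_AbsRing} {ip : X -> X -> C}.
Hypothesis Hip : is_inner_product X ip.
Local Notation Z := (prod_CompleteNormedModule C_AbsRing X X).
Variables (DS : X -> Prop) (S B K : X -> X) (k : R).
Hypothesis HS : linear_on X DS S.
Hypothesis HSsym : forall x y, DS x -> DS y -> ip y (S x) = ip (S y) x.
Hypothesis HB : linear_on X DS B.
Hypothesis HK : linear_on X (fun _ => True) K.
Hypothesis Hk : 0 <= k.
Hypothesis HKk : forall u, norm (K u) <= k * norm u.

Definition wave_domain (p : Z) : Prop := DS (fst p) /\ DS (snd p).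

Definition wave_op (p : Z) : Z :=
  (scal (RtoC (-1)) (S (snd p)), plus (plus (S (fst p)) (scal Ci (B (snd p)))) (K (fst p))).

Lemma wave_domain_subspace : is_subspace Z wave_domain.
Proof.
  split; [split; apply (domain_zero HS)|]. split.
  - intros p q [H1 H2] [H3 H4]. split; apply (domain_plus HS); assumption.
  - intros a p [H1 H2]. split; apply (domain_scal HS); assumption.
Qed.

Lemma wave_op_linear : linear_on Z wave_domain wave_op.
Proof.
  split; [apply wave_domain_subspace|]. split.
  - intros [u v] [u' v'] [Hu Hv] [Hu' Hv']. simpl in Hu, Hv, Hu', Hv'. rewrite !plus_pair. unfold wave_op. cbn [fst snd].
    rewrite !(linear_on_plus HS), (linear_on_plus HB), (linear_on_plus HK) by auto. f_equal; vec Hip.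
  - intros a [u v] [Hu Hv]. simpl in Hu, Hv. rewrite !scal_pair. unfold wave_op. cbn [fst snd].
    rewrite !(linear_on_scal HS), (linear_on_scal HB), (linear_on_scal HK) by auto. f_equal; vec Hip.
Qed.

Lemma wave_domain_dense : densely_defined X DS -> densely_defined Z wave_domain.
Proof.
  intros HD [x1 x2] e He. destruct (HD x1 (e / 2)) as [y1 [H1 E1]]; [lra|].
  destruct (HD x2 (e / 2)) as [y2 [H2 E2]]; [lra|].
  exists (y1, y2). split; [split; assumption|].
  pose proof (norm_ge_0 (minus x1 y1)). pose proof (norm_ge_0 (minus x2 y2)).
  apply Rnot_le_lt. intros Hc.
  apply (fun H => pow_incr _ _ 2 (conj (Rlt_le _ _ He) H)) in Hc.
  rewrite norm_prod_sqr, !minus_pair in Hc. cbn [fst snd] in Hc. nra.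
Qed.

Lemma Re_ip_S_swap u v : DS u -> DS v -> Re (ip u (S v)) = Re (ip v (S u)).
Proof. intros Hu Hv. rewrite (HSsym v u Hv Hu). apply (Re_ip_sym Hip). Qed.

(** By symmetry of [S] the terms [- <u|S v>] and [<v|S u>] cancel in the real part. There remain
    [Re (i <v|B v>)] and [Re <v|K u>], the latter at least [- k |u| |v|], hence at least
    [- k (|u|^2 + |v|^2)]. *)
Lemma wave_op_accretive M : 0 <= M -> (forall v, DS v -> - M * norm v ^ 2 <= Re (Ci * ip v (B v))) ->
  accretive_shift (ip := ip_prod ip) wave_domain wave_op (M + k).
Proof.
  intros HM Hdiss [u v] [Hu Hv]. simpl in Hu, Hv. rewrite norm_prod_sqr.
  unfold ip_prod, wave_op. cbn [fst snd]. ip_simpl Hip.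
  assert (H1 := Re_ip_S_swap u v Hu Hv). specialize (Hdiss v Hv).
  assert (H2 : - (norm v * norm (K u)) <= Re (ip v (K u))).
  { pose proof (Re_ip_le Hip v (scal (RtoC (-1)) (K u))) as H.
    rewrite (ip_scal_r Hip), re_scal_l, norm_scal_C, Cmod_R, Rabs_left in H by lra. lra. }
  specialize (HKk u). pose proof (norm_ge_0 u). pose proof (norm_ge_0 v).
  assert (H3 : norm v * norm (K u) <= k * (norm u ^ 2 + norm v ^ 2)).
  { apply Rle_trans with (norm v * (k * norm u)); [apply Rmult_le_compat_l; lra|].
    assert (0 <= k * (norm u - norm v) ^ 2) by (apply Rmult_le_pos; [lra|apply pow2_ge_0]).
    assert (0 <= k * norm u ^ 2) by (apply Rmult_le_pos; [lra|apply pow2_ge_0]).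
    assert (0 <= k * norm v ^ 2) by (apply Rmult_le_pos; [lra|apply pow2_ge_0]). nra. }
  assert (0 <= M * norm u ^ 2) by (apply Rmult_le_pos; [lra|apply pow2_ge_0]).
  unfold Re in *. unfold Cplus, Cmult, RtoC in *; cbn [fst snd] in *. lra.
Qed.

(* The free resolvent is explicit: [(L + G0)^-1 = (L - G0) (L^2 + S^2)^-1] since [G0^2 = - S^2]. *)
Lemma wave_op_onto (a b : R) : 0 <= a < 1 ->
  (forall x, DS x -> norm (B x) ^ 2 <= a ^ 2 * norm (S x) ^ 2 + b ^ 2 * norm x ^ 2) ->
  (forall L f, 0 < L -> exists w, DS w /\ DS (S w) /\ plus (S (S w)) (scal (RtoC (L ^ 2)) w) = f) ->
  exists L0, forall L, L0 < L -> forall y, exists x : Z,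
    wave_domain x /\ plus (wave_op x) (scal (RtoC L) x) = y.
Proof.
  (* With [N] the norm of the skew part plus [L] at [(u, v)], [L > 2 |b|] gives
     [|B v| <= (1 + a)/2 N] and [L (1 - a) > 4 k] gives [|K u| <= (1 - a)/4 N]; the sum of the
     factors is [(3 + a)/4 < 1]. *)
  intros Ha HBb Hres. exists (Rmax 1 (Rmax (2 * Rabs b) (4 * k / (1 - a)))). intros L HL y.
  pose proof (Rmax_l 1 (Rmax (2 * Rabs b) (4 * k / (1 - a)))).
  pose proof (Rmax_r 1 (Rmax (2 * Rabs b) (4 * k / (1 - a)))).
  pose proof (Rmax_l (2 * Rabs b) (4 * k / (1 - a))). pose proof (Rmax_r (2 * Rabs b) (4 * k / (1 - a))).
  assert (HL1 : 1 < L) by lra. assert (HLb : 2 * Rabs b < L) by lra.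
  assert (HLk : 4 * k < L * (1 - a)).
  { assert (H3 : 4 * k / (1 - a) < L) by lra. apply (Rmult_lt_compat_r (1 - a)) in H3; [|lra].
    replace (4 * k / (1 - a) * (1 - a)) with (4 * k) in H3 by (field; lra). lra. }
  clear H H0 H1 H2 HL.
  set (T := fun p : Z => (plus (scal (RtoC (-1)) (S (snd p))) (scal (RtoC L) (fst p)),
                          plus (S (fst p)) (scal (RtoC L) (snd p))) : Z).
  set (P := fun p : Z => (zero, plus (scal Ci (B (snd p))) (K (fst p))) : Z).
  assert (HT : linear_on Z wave_domain T).
  { split; [apply wave_domain_subspace|]. split.
    - intros [u v] [u' v'] [Hu Hv] [Hu' Hv']. simpl in Hu, Hv, Hu', Hv'. rewrite !plus_pair. unfold T. cbn [fst snd].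
      rewrite !(linear_on_plus HS) by auto. f_equal; vec Hip.
    - intros c [u v] [Hu Hv]. simpl in Hu, Hv. rewrite !scal_pair. unfold T. cbn [fst snd].
      rewrite !(linear_on_scal HS) by auto. f_equal; vec Hip. }
  assert (HP : linear_on Z wave_domain P).
  { split; [apply wave_domain_subspace|]. split.
    - intros [u v] [u' v'] [Hu Hv] [Hu' Hv']. simpl in Hu, Hv, Hu', Hv'. rewrite !plus_pair. unfold P. cbn [fst snd].
      rewrite !(linear_on_plus HB), (linear_on_plus HK) by auto. f_equal; vec Hip.
    - intros c [u v] [Hu Hv]. simpl in Hu, Hv. rewrite !scal_pair. unfold P. cbn [fst snd].
      rewrite !(linear_on_scal HB), (linear_on_scal HK) by auto. f_equal; vec Hip. }
  destruct (onto_perturbation HT (ip_prod_is_inner_product ip Hip) P ((3 + a) / 4) HP) with (y := y)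
    as [x [Hx Ex]].
  - lra.
  - intros [f g]. destruct (Hres L f ltac:(lra)) as [w [Dw [DSw Ew]]].
    destruct (Hres L g ltac:(lra)) as [w' [Dw' [DSw' Ew']]].
    exists (plus (scal (RtoC L) w) (S w'), minus (scal (RtoC L) w') (S w)).
    assert (D1 : DS (scal (RtoC L) w)) by (apply (domain_scal HS); assumption).
    assert (D2 : DS (scal (RtoC L) w')) by (apply (domain_scal HS); assumption).
    split; [split; [apply (domain_plus HS)|apply (domain_minus HS)]; assumption|].
    unfold T. cbn [fst snd].
    rewrite (linear_on_plus HS), (linear_on_minus HS), !(linear_on_scal HS), <- Ew, <- Ew' by assumption.
    simpl (L ^ 2). rewrite Rmult_1_r, RtoC_mult. f_equal; vec Hip.
  - intros [u v] [Hu Hv]. simpl in Hu, Hv.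
    set (N := norm (T (u, v))). assert (HN : 0 <= N) by apply norm_ge_0.
    (* Skewness cancels the cross terms [- 2 L Re <S v|u>] and [2 L Re <S u|v>]. *)
    assert (EN : N ^ 2 = L ^ 2 * (norm u ^ 2 + norm v ^ 2) + norm (S v) ^ 2 + norm (S u) ^ 2).
    { unfold N. rewrite norm_prod_sqr. unfold T; cbn [fst snd].
      rewrite !(norm_plus_sqr Hip), !norm_scal_C, !Cmod_R, Rabs_left, (Rabs_pos_eq L) by lra.
      rewrite (ip_scal_l Hip), !(ip_scal_r Hip).
      assert (H1 := Re_ip_S_swap u v Hu Hv). rewrite (Re_ip_sym Hip (S v)) in H1.
      pose proof (Re_ip_sym Hip v (S u)) as H2.
      unfold Re in *. unfold Cmult, Cconj, RtoC; cbn [fst snd]. nra. }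
    assert (H1 : norm (P (u, v)) <= norm (B v) + norm (K u)).
    { set (w := plus (scal Ci (B v)) (K u)).
      assert (E : norm (P (u, v)) ^ 2 = norm w ^ 2).
      { rewrite norm_prod_sqr. unfold P; cbn [fst snd]. fold w.
        rewrite <- (Re_ip_self Hip zero), (ip_zero_l Hip). simpl. ring. }
      assert (Hw : norm w <= norm (B v) + norm (K u)).
      { unfold w. eapply Rle_trans; [exact (norm_triangle (scal Ci (B v)) (K u))|].
        rewrite norm_scal_C. replace (Cmod Ci) with 1; [lra|].
        unfold Cmod, Ci; simpl. replace (0 * (0 * 1) + 1 * (1 * 1)) with 1 by ring. symmetry; apply sqrt_1. }
      pose proof (norm_ge_0 (P (u, v))). pose proof (norm_ge_0 w). nra. }
    pose proof (norm_ge_0 u). pose proof (norm_ge_0 v).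
    pose proof (pow2_ge_0 (norm u)). pose proof (pow2_ge_0 (norm v)).
    pose proof (pow2_ge_0 (norm (S u))). pose proof (pow2_ge_0 (norm (S v))).
    assert (HL2 : 0 < L ^ 2) by nra.
    assert (HBv : norm (B v) <= (1 + a) / 2 * N).
    { apply Rnot_lt_le. intros Hc. specialize (HBb v Hv).
      assert (Hsq : ((1 + a) / 2 * N) ^ 2 < norm (B v) ^ 2).
      { assert (0 <= (1 + a) / 2 * N) by (apply Rmult_le_pos; lra). nra. }
      assert (Hb2 : b ^ 2 <= ((1 + a) / 2) ^ 2 * L ^ 2).
      { rewrite <- (pow2_abs b). pose proof (Rabs_pos b). rewrite <- Rpow_mult_distr.
        apply pow_incr. split; [lra|]. nra. }
      assert (b ^ 2 * norm v ^ 2 <= ((1 + a) / 2) ^ 2 * L ^ 2 * norm v ^ 2) by (apply Rmult_le_compat_r; lra).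
      assert (Ha2 : a ^ 2 <= ((1 + a) / 2) ^ 2) by (apply pow_incr; lra).
      assert (a ^ 2 * norm (S v) ^ 2 <= ((1 + a) / 2) ^ 2 * norm (S v) ^ 2) by (apply Rmult_le_compat_r; lra).
      rewrite Rpow_mult_distr, EN in Hsq.
      assert (0 <= ((1 + a) / 2) ^ 2 * (L ^ 2 * norm u ^ 2)).
      { apply Rmult_le_pos; [apply pow2_ge_0|apply Rmult_le_pos; lra]. }
      assert (0 <= ((1 + a) / 2) ^ 2 * norm (S u) ^ 2) by (apply Rmult_le_pos; [apply pow2_ge_0|lra]).
      lra. }
    assert (HKu : norm (K u) <= (1 - a) / 4 * N).
    { apply Rle_trans with (1 := HKk u).
      assert (HLu : L * norm u <= N).
      { apply Rnot_lt_le. intros Hc. assert (N ^ 2 < (L * norm u) ^ 2) by nra.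
        rewrite Rpow_mult_distr in *. assert (0 <= L ^ 2 * norm v ^ 2) by (apply Rmult_le_pos; lra). lra. }
      apply Rle_trans with ((1 - a) / 4 * (L * norm u)); [nra|]. apply Rmult_le_compat_l; lra. }
    fold N. lra.
  - exists x. split; [assumption|]. rewrite <- Ex. destruct x as [u v]. unfold T, P, wave_op.
    rewrite !plus_pair, scal_pair. cbn [fst snd]. f_equal; vec Hip.
Qed.

End Wave.

(** * Transfer to the energy space *)

Section Transfer.
Context {X : CompleteNormedModule C_AbsRing} {ip : X -> X -> C}.
Hypothesis Hip : is_inner_product X ip.
Local Notation Z := (prod_CompleteNormedModule C_AbsRing X X).
Variables (DA DS : X -> Prop) (S Sinv : X -> X) (s : R).
Hypothesis HS : linear_on X DS S.
Hypothesis HDA : forall x, DA x <-> DS x /\ DS (S x).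
Hypothesis HSinv : forall u, DS (Sinv u) /\ S (Sinv u) = u.
Hypothesis HSinj : forall x, DS x -> Sinv (S x) = x.
Hypothesis Hs : s * s = 1.

(** The sign [s] is 1 for [G_+] and -1 for [G_-]; [s * s = 1] is all that the transfer uses, so one
    section serves both. *)
Definition to_prod (p : X * X) : Z := (S (fst p), scal (RtoC s) (snd p)).
Definition of_prod (z : Z) : X * X := (Sinv (fst z), scal (RtoC s) (snd z)).
Local Notation Y := (inY X DS).
Local Notation nY := (normY X ip S).

Lemma scal_sign_invol (x : X) : scal (RtoC s) (scal (RtoC s) x) = x.
Proof.
  transitivity (scal (RtoC (s * s)) x); [rewrite RtoC_mult|rewrite Hs]; vec Hip.
Qed.

Lemma to_of_prod z : to_prod (of_prod z) = z.
Proof.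
  destruct z as [u v]. unfold to_prod, of_prod. cbn [fst snd].
  rewrite scal_sign_invol, (proj2 (HSinv u)). reflexivity.
Qed.

Lemma of_to_prod p : Y p -> of_prod (to_prod p) = p.
Proof.
  destruct p as [x y]. intros Hp. unfold to_prod, of_prod. cbn [fst snd].
  rewrite scal_sign_invol, (HSinj x Hp). reflexivity.
Qed.

Lemma of_prod_Y z : Y (of_prod z).
Proof. apply HSinv. Qed.

Lemma to_prod_inj p q : Y p -> Y q -> to_prod p = to_prod q -> p = q.
Proof. intros Hp Hq E. rewrite <- (of_to_prod p Hp), <- (of_to_prod q Hq), E. reflexivity. Qed.

Lemma plusY_Y p q : Y p -> Y q -> Y (plusY X p q).
Proof. apply (domain_plus HS). Qed.
Lemma minusY_Y p q : Y p -> Y q -> Y (minusY X p q).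
Proof. apply (domain_minus HS). Qed.
Lemma scalY_Y a p : Y p -> Y (scalY X a p).
Proof. apply (domain_scal HS). Qed.

Lemma to_prod_plus p q : Y p -> Y q -> to_prod (plusY X p q) = plus (to_prod p) (to_prod q).
Proof.
  intros Hp Hq. rewrite plus_pair. unfold to_prod, plusY. cbn [fst snd].
  rewrite (linear_on_plus HS) by assumption. f_equal. vec Hip.
Qed.

Lemma to_prod_minus p q : Y p -> Y q -> to_prod (minusY X p q) = minus (to_prod p) (to_prod q).
Proof.
  intros Hp Hq. rewrite minus_pair. unfold to_prod, minusY. cbn [fst snd].
  rewrite (linear_on_minus HS) by assumption. f_equal. vec Hip.
Qed.

Lemma to_prod_scal a p : Y p -> to_prod (scalY X a p) = scal a (to_prod p).
Proof.
  intros Hp. rewrite scal_pair. unfold to_prod, scalY. cbn [fst snd].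
  rewrite (linear_on_scal HS) by assumption. f_equal. vec Hip.
Qed.

Lemma Re_innerY p q : Re (innerY X ip S p q) = Re (ip_prod ip (to_prod p) (to_prod q)).
Proof.
  unfold innerY, ip_prod, to_prod. cbn [fst snd]. rewrite (ip_scal_l Hip), (ip_scal_r Hip).
  unfold Re, Cplus, Cmult, Cconj, RtoC; cbn [fst snd].
  rewrite <- (Rmult_1_l (fst (ip (snd p) (snd q)))) at 1. rewrite <- Hs. ring.
Qed.

Lemma normY_eq p : nY p = norm (to_prod p).
Proof.
  unfold normY. rewrite Re_innerY, (Re_ip_self (ip_prod_is_inner_product ip Hip)).
  apply sqrt_pow2, norm_ge_0.
Qed.

Variables (G : X * X -> X * X) (K : Z -> Z).
Local Notation DZ := (wave_domain DS).
Local Notation DG := (DH X DA DS).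
Hypothesis HK : linear_on Z DZ K.
Hypothesis HDS : densely_defined X DS.
Hypothesis HGY : forall p, DG p -> Y (G p).
Hypothesis HGK : forall p, DG p -> to_prod (G p) = K (to_prod p).

(** The description of [D(A)] as the [x] in [D(S)] with [S x] in [D(S)] is what makes the image of
    [D(A) x D(S)] equal to [D(S) x D(S)]. *)
Lemma DG_iff p : DG p <-> Y p /\ DZ (to_prod p).
Proof.
  destruct p as [x y]. unfold DH, inY, wave_domain, to_prod. cbn [fst snd]. rewrite HDA. split.
  - intros [[H1 H2] H3]. repeat split; try assumption. apply (domain_scal HS), H3.
  - intros [H1 [H2 H3]]. repeat split; try assumption.
    rewrite <- (scal_sign_invol y). apply (domain_scal HS), H3.
Qed.

Lemma DG_of_prod z : DZ z -> DG (of_prod z).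
Proof. intros Hz. apply DG_iff. rewrite to_of_prod. split; [apply of_prod_Y|exact Hz]. Qed.

Lemma accretive_transfer mu :
  (forall p, DG p -> Re (innerY X ip S p (G p)) >= - mu * Re (innerY X ip S p p)) ->
  accretive_shift (ip := ip_prod ip) DZ K mu.
Proof.
  intros H z Hz. specialize (H _ (DG_of_prod z Hz)). rewrite !Re_innerY in H.
  rewrite (HGK _ (DG_of_prod z Hz)), to_of_prod, (Re_ip_self (ip_prod_is_inner_product ip Hip)) in H.
  apply Rge_le, H.
Qed.

(** The shift is [- z], whose real part exceeds [mu]. Surjectivity comes from [accretive_onto]; the
    lower bound by [r = Re (-z) - mu] gives the left inverse as well as the norm bound [1 / r]. *)
Lemma resolvent_transfer mu L0 (z : C) : accretive_shift (ip := ip_prod ip) DZ K mu ->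
  (forall L, L0 < L -> forall y, exists x, DZ x /\ plus (K x) (scal (RtoC L) x) = y) ->
  Re z < - mu -> resolvent X ip DS S DG G z.
Proof.
  pose proof (ip_prod_is_inner_product ip Hip) as HipZ.
  intros Hmu Hlarge Hz.
  assert (Hmz : mu < Re (- z)) by (unfold Re, Copp in *; cbn [fst]; lra).
  destruct (choice _ (accretive_onto HipZ DZ K HK mu L0 Hmu Hlarge (- z)%C Hmz)) as [R0 HR].
  assert (Hlow := fun x => accretive_shift_lower_bound HipZ DZ K mu (- z)%C x Hmu).
  set (r := Re (- z) - mu) in *. assert (Hr : 0 < r) by (unfold r; lra).
  assert (HGz : forall p, DG p ->
    to_prod (minusY X (G p) (scalY X z p)) = plus (K (to_prod p)) (scal (- z)%C (to_prod p))).
  { intros p Hp. assert (Yp : Y p) by (apply DG_iff, Hp).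
    rewrite to_prod_minus, to_prod_scal, (HGK p Hp) by auto using scalY_Y. vec HipZ. }
  exists (fun q => of_prod (R0 (to_prod q))). split; [|split].
  - intros q Hq. destruct (HR (to_prod q)) as [Dx Ex]. pose proof (DG_of_prod _ Dx) as Dp. split; [assumption|].
    apply to_prod_inj; [apply minusY_Y; [auto|apply scalY_Y, of_prod_Y]|assumption|].
    rewrite (HGz _ Dp), to_of_prod. exact Ex.
  - intros p Hp. assert (Hp' := Hp). apply DG_iff in Hp'. destruct Hp' as [Yp Dp].
    set (q := minusY X (G p) (scalY X z p)). destruct (HR (to_prod q)) as [Dx Ex].
    set (x := R0 (to_prod q)) in *. rewrite <- (of_to_prod p Yp). f_equal.
    apply norm_dist_zero_eq. pose proof (Hlow _ (domain_minus HK _ _ Dx Dp)) as H.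
    rewrite (linear_on_minus HK) in H by assumption.
    replace (plus _ _) with (minus (to_prod q) (to_prod q)) in H.
    + rewrite norm_minus_self in H. nra.
    + rewrite <- Ex at 1. unfold q. rewrite (HGz p Hp). vec HipZ.
  - exists (/ r). intros q Hq. rewrite !normY_eq, to_of_prod. destruct (HR (to_prod q)) as [Dx Ex].
    pose proof (Hlow _ Dx) as H. rewrite Ex in H. apply Rmult_le_reg_l with r; [lra|].
    rewrite <- Rmult_assoc, Rinv_r, Rmult_1_l by lra. exact H.
Qed.

Lemma generation_transfer L0 : (exists x : X, x <> zero) ->
  (exists m, accretive_shift (ip := ip_prod ip) DZ K m) ->
  (forall L, L0 < L -> forall y, exists x, DZ x /\ plus (K x) (scal (RtoC L) x) = y) ->
  exists T : R -> X * X -> X * X,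
     sc_semigroup X ip DS S T /\ generator X ip DS S DG G T /\
     forall mu : R,
       (forall p, DG p -> Re (innerY X ip S p (G p)) >= - mu * Re (innerY X ip S p p)) ->
       (forall z : C, in_spectrum X ip DS S DG G z -> Re z >= - mu) /\
       (forall t p, 0 <= t -> Y p -> nY (T t p) <= exp (mu * t) * nY p).
Proof.
  intros [x0 Hx0] Hex Hlarge. pose proof (ip_prod_is_inner_product ip Hip) as HipZ.
  pose proof (wave_domain_dense DS HDS) as HDZ.
  destruct (accretive_shift_optimal HipZ DZ K HDZ) as [m [Hm Hmin]]; [|assumption|].
  { exists (x0, zero). intros E. apply Hx0. exact (f_equal fst E). }
  destruct (accretive_shift_generates HipZ DZ K HK HDZ m L0 Hm Hlarge) as [T HT].
  set (TY := fun t p => of_prod (T t (to_prod p))).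
  assert (HTY : forall t p, to_prod (TY t p) = T t (to_prod p)) by (intros; apply to_of_prod).
  assert (YT : forall t p, Y (TY t p)) by (intros; apply of_prod_Y).
  assert (Hdiff : forall t p, Y p ->
    to_prod (scalY X (RtoC (/ t)) (minusY X (TY t p) p)) = diff_quotient T (to_prod p) t).
  { intros t p Hp. rewrite to_prod_scal, to_prod_minus, HTY by auto using minusY_Y. reflexivity. }
  assert (Hlim : forall p l, Y p -> Y l ->
    right_limit_Y X ip S (fun t => scalY X (RtoC (/ t)) (minusY X (TY t p) p)) l <->
    right_limit (diff_quotient T (to_prod p)) (to_prod l)).
  { intros p l Hp Hl. split; intros H e He; destruct (H e He) as [d [Hd Hb]]; exists d; (split; [assumption|]);
      intros t Ht; specialize (Hb t Ht).
    - rewrite normY_eq, to_prod_minus, Hdiff in Hb by auto using minusY_Y, scalY_Y. exact Hb.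
    - rewrite normY_eq, to_prod_minus, Hdiff by auto using minusY_Y, scalY_Y. exact Hb. }
  exists TY. split; [|split].
  - split; [|split; [|split]].
    + intros t Ht. split; [|split; [|split]].
      * intros p Hp. apply YT.
      * intros p q Hp Hq. apply to_prod_inj; auto using plusY_Y.
        rewrite to_prod_plus, !HTY, to_prod_plus by auto. apply (gen_plus _ _ _ _ HT), Ht.
      * intros a p Hp. apply to_prod_inj; auto using scalY_Y.
        rewrite to_prod_scal, !HTY, to_prod_scal by auto. apply (gen_scal _ _ _ _ HT), Ht.
      * exists (exp (m * t)). intros p Hp. rewrite !normY_eq, HTY. apply (gen_bound _ _ _ _ HT), Ht.
    + intros p Hp. apply to_prod_inj; auto. rewrite HTY. apply (gen_0 _ _ _ _ HT).
    + intros r t p Hr Ht Hp. apply to_prod_inj; auto. rewrite !HTY. apply (gen_add _ _ _ _ HT); assumption.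
    + intros p Hp e He. destruct (gen_strong _ _ _ _ HT (to_prod p) e He) as [d [Hd H]].
      exists d. split; [assumption|]. intros t Ht. rewrite normY_eq, to_prod_minus, HTY by auto. apply H, Ht.
  - assert (Hder : forall p, DG p -> right_limit_Y X ip S
      (fun t => scalY X (RtoC (/ t)) (minusY X (TY t p) p)) (scalY X (RtoC (-1)) (G p))).
    { intros p Hp. assert (Hp' := Hp). apply DG_iff in Hp'. destruct Hp' as [Yp Dp].
      apply Hlim; auto using scalY_Y. rewrite to_prod_scal, HGK by auto.
      apply (gen_derivative _ _ _ _ HT), Dp. }
    split; [|exact Hder]. intros p. split.
    + intros Hp. split; [apply DG_iff, Hp|]. exists (scalY X (RtoC (-1)) (G p)).
      split; [apply scalY_Y; auto|apply Hder, Hp].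
    + intros [Yp [l [Yl Hl]]]. apply DG_iff. split; [assumption|].
      apply (gen_domain _ _ _ _ HT) with (to_prod l). apply Hlim; assumption.
  - intros mu Hmu. apply accretive_transfer in Hmu. split.
    + intros z Hz. apply Rnot_lt_ge. intros Hlt. apply Hz.
      apply (resolvent_transfer mu L0); assumption.
    + intros t p Ht Hp. rewrite !normY_eq, HTY. apply Rle_trans with (1 := gen_bound _ _ _ _ HT t _ Ht).
      apply Rmult_le_compat_r; [apply norm_ge_0|]. specialize (Hmin mu Hmu).
      assert (Hle : m * t <= mu * t) by (apply Rmult_le_compat_r; assumption).
      destruct Hle as [Hlt|Heq]; [apply Rlt_le, exp_increasing, Hlt|rewrite Heq; lra].
Qed.

End Transfer.

(** * The square root of a coercive operator *)

Section SquareRoot.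
Context {X : CompleteNormedModule C_AbsRing} {ip : X -> X -> C}.
Hypothesis Hip : is_inner_product X ip.
Variables (DA : X -> Prop) (A : X -> X) (eps : R) (DS : X -> Prop) (S : X -> X).
Hypothesis HAlin : linear_on X DA A.
Hypothesis HAdense : densely_defined X DA.
Hypothesis HAsa : self_adjoint X ip DA A.
Hypothesis Heps : 0 < eps.
Hypothesis HApos : forall x, DA x -> eps * norm x ^ 2 <= Re (ip x (A x)).
Hypothesis HS : pos_sqrt X ip DA A DS S.

Lemma pos_sqrt_linear : linear_on X DS S.
Proof. apply HS. Qed.

Lemma pos_sqrt_sym x y : DS x -> DS y -> ip y (S x) = ip (S y) x.
Proof. apply HS. Qed.

Lemma pos_sqrt_domain x : DA x <-> DS x /\ DS (S x).
Proof. apply HS. Qed.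

Lemma pos_sqrt_sqr x : DA x -> A x = S (S x).
Proof. apply HS. Qed.

(** Used twice: [k = 0] solves [A w = f] and leads to [S^-1], and [k = L^2] gives the resolvent
    behind the free wave operator. *)
Lemma coercive_shift_onto k f : 0 <= k ->
  exists w, DS w /\ DS (S w) /\ plus (S (S w)) (scal (RtoC k) w) = f.
Proof.
  intros Hk.
  destruct (self_adjoint_coercive_onto Hip DA (fun x => plus (A x) (scal (RtoC k) x)) eps)
    with (f := f) as [w [Hw Ew]]; auto.
  - apply (linear_on_shift HAlin Hip).
  - apply (self_adjoint_shift Hip), HAsa.
  - intros x Hx. rewrite (ip_plus_r Hip), (ip_scal_r Hip), (ip_norm _ _ Hip). specialize (HApos x Hx).
    assert (0 <= k * norm x ^ 2) by (apply Rmult_le_pos; [assumption|apply pow2_ge_0]).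
    unfold Re in *. unfold Cplus, Cmult, RtoC; cbn [fst snd]. lra.
  - exists w. destruct (proj1 (pos_sqrt_domain w) Hw). repeat split; try assumption.
    rewrite <- (pos_sqrt_sqr w Hw). exact Ew.
Qed.

(** As [S x = zero] lies in [DS], [x] is in [D(A)], where [<x|A x> = <S x|S x> = 0] contradicts
    coercivity unless [x] is zero. *)
Lemma pos_sqrt_kernel x : DS x -> S x = zero -> x = zero.
Proof.
  intros Hx E. assert (Dx : DA x).
  { apply pos_sqrt_domain. split; [assumption|]. rewrite E. apply (domain_zero pos_sqrt_linear). }
  specialize (HApos x Dx). rewrite (pos_sqrt_sqr x Dx) in HApos.
  rewrite (pos_sqrt_sym (S x) x), E, (ip_zero_l Hip) in HApos; [|apply pos_sqrt_domain, Dx|assumption].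
  apply (ip_self_eq_zero Hip). rewrite (Re_ip_self Hip). simpl Re in HApos. nra.
Qed.

Lemma pos_sqrt_injective x y : DS x -> DS y -> S x = S y -> x = y.
Proof.
  intros Hx Hy E. apply minus_eq_zero_eq. apply pos_sqrt_kernel; [apply (domain_minus pos_sqrt_linear); assumption|].
  rewrite (linear_on_minus pos_sqrt_linear), E by assumption. exact (minus_eq_zero (S y)).
Qed.

(** The solution is [x = S w] with [A w = u]. Then [|x|^2 = Re <w|u> <= |w| |u|], and
    [eps |w| <= |u|] by coercivity of [A]. *)
Lemma pos_sqrt_onto u : exists x, DS x /\ S x = u /\ eps * norm x ^ 2 <= norm u ^ 2.
Proof.
  destruct (coercive_shift_onto 0 u (Rle_refl 0)) as [w [Hw [HSw Ew]]].
  assert (E : S (S w) = u) by (rewrite <- Ew; vec Hip).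
  assert (Dw : DA w) by (apply pos_sqrt_domain; split; assumption).
  exists (S w). split; [assumption|]. split; [exact E|].
  specialize (HApos w Dw). rewrite (pos_sqrt_sqr w Dw), E in HApos.
  pose proof (norm_le_lower_bound Hip w u eps HApos) as H1.
  assert (H2 : norm (S w) ^ 2 = Re (ip w u)).
  { rewrite <- E, (pos_sqrt_sym (S w) w HSw Hw), (Re_ip_self Hip). reflexivity. }
  pose proof (Re_ip_le Hip w u). pose proof (norm_ge_0 w). pose proof (norm_ge_0 u). nra.
Qed.

Lemma pos_sqrt_inverse : exists Sinv : X -> X,
  (forall u, DS (Sinv u) /\ S (Sinv u) = u) /\
  (forall x, DS x -> Sinv (S x) = x) /\
  (forall u, eps * norm (Sinv u) ^ 2 <= norm u ^ 2) /\
  linear_on X (fun _ => True) Sinv.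
Proof.
  destruct (choice _ pos_sqrt_onto) as [Sinv H]. exists Sinv.
  assert (H1 : forall u, DS (Sinv u)) by apply H. assert (H2 : forall u, S (Sinv u) = u) by apply H.
  split; [auto|]. split; [|split; [apply H|]].
  - intros x Hx. apply pos_sqrt_injective; auto.
  - split; [repeat split|]. split.
    + intros x y _ _. apply pos_sqrt_injective; auto using (domain_plus pos_sqrt_linear).
      rewrite (linear_on_plus pos_sqrt_linear), !H2; auto.
    + intros a x _. apply pos_sqrt_injective; auto using (domain_scal pos_sqrt_linear).
      rewrite (linear_on_scal pos_sqrt_linear), !H2; auto.
Qed.

Lemma pos_sqrt_dense : densely_defined X DS.
Proof.
  intros x e He. destruct (HAdense x e He) as [y [Hy Hn]]. exists y.
  split; [apply pos_sqrt_domain, Hy|assumption].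
Qed.

End SquareRoot.

(** The absolute value lets one [M] serve both [B] and [- B]. For symmetric [B] the number [<v|B v>]
    is real, so [M = 0]; for bounded [B] it is Cauchy-Schwarz. *)
Lemma symmetric_or_bounded_form {X : CompleteNormedModule C_AbsRing} {ip : X -> X -> C}
  (DS : X -> Prop) (B : X -> X) : is_inner_product X ip ->
  (forall x y, DS x -> DS y -> ip (B x) y = ip x (B y)) \/
  (exists M : R, forall x, DS x -> norm (B x) <= M * norm x) ->
  exists M, 0 <= M /\ forall v, DS v -> Rabs (Re (Ci * ip v (B v))) <= M * norm v ^ 2.
Proof.
  intros Hip [Hsym|[M HM]].
  - exists 0. split; [lra|]. intros v Hv. specialize (Hsym v v Hv Hv). rewrite (ip_sym Hip) in Hsym.
    apply (f_equal snd) in Hsym. unfold Cconj in Hsym; cbn [snd] in Hsym.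
    unfold Re, Ci, Cmult; cbn [fst snd].
    replace (0 * fst (ip v (B v)) - 1 * snd (ip v (B v))) with 0 by lra. rewrite Rabs_R0. lra.
  - exists (Rabs M). split; [apply Rabs_pos|]. intros v Hv.
    apply Rle_trans with (norm v * norm (B v)).
    + eapply Rle_trans; [eapply Rle_trans; [apply Rmax_l|apply Rmax_Cmod]|]. rewrite Cmod_mult.
      replace (Cmod Ci) with 1; [rewrite Rmult_1_l; apply (Cmod_ip_le Hip)|].
      unfold Cmod, Ci; simpl. replace (0 * (0 * 1) + 1 * (1 * 1)) with 1 by ring. symmetry; apply sqrt_1.
    + specialize (HM v Hv). pose proof (norm_ge_0 v). pose proof (Rle_abs M). nra.
Qed.

Theorem theorem7
  (X : CompleteNormedModule C_AbsRing) (ip : X -> X -> C)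
  (Hip : is_inner_product X ip)
  (Hnontriv : exists x : X, x <> zero)
  (DA : X -> Prop) (A : X -> X) (eps : R)
  (HAlin : linear_on X DA A) (HAdense : densely_defined X DA)
  (HAsa : self_adjoint X ip DA A)
  (Heps : 0 < eps)
  (HApos : forall x, DA x -> Re (ip x (A x)) >= eps * Re (ip x x))
  (DS : X -> Prop) (S : X -> X) (HS : pos_sqrt X ip DA A DS S)
  (B : X -> X) (a b : R) (HBlin : linear_on X DS B)
  (Ha : 0 <= a < 1)
  (HBbd : forall x, DS x -> norm (B x) ^ 2 <= a ^ 2 * norm (S x) ^ 2 + b ^ 2 * norm x ^ 2)
  (HBsym : (forall x y, DS x -> DS y -> ip (B x) y = ip x (B y)) \/
           (exists M : R, forall x, DS x -> norm (B x) <= M * norm x))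
  (Cop : X -> X) (c d : R) (HClin : linear_on X DS Cop)
  (HCbd : forall x, DS x -> norm (Cop x) ^ 2 <= c ^ 2 * norm (S x) ^ 2 + d ^ 2 * norm x ^ 2) :
  (exists Tp : R -> X * X -> X * X,
     sc_semigroup X ip DS S Tp /\
     generator X ip DS S (DH X DA DS) (Gplus X A B Cop) Tp /\
     forall mu : R,
       (forall p, DH X DA DS p ->
          Re (innerY X ip S p (Gplus X A B Cop p)) >= - mu * Re (innerY X ip S p p)) ->
       (forall z : C, in_spectrum X ip DS S (DH X DA DS) (Gplus X A B Cop) z -> Re z >= - mu) /\
       (forall t p, 0 <= t -> inY X DS p ->
          normY X ip S (Tp t p) <= exp (mu * t) * normY X ip S p)) /\
  (exists Tm : R -> X * X -> X * X,
     sc_semigroup X ip DS S Tm /\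
     generator X ip DS S (DH X DA DS) (Gminus X A B Cop) Tm /\
     forall mu : R,
       (forall p, DH X DA DS p ->
          Re (innerY X ip S p (Gminus X A B Cop p)) >= - mu * Re (innerY X ip S p p)) ->
       (forall z : C, in_spectrum X ip DS S (DH X DA DS) (Gminus X A B Cop) z -> Re z >= - mu) /\
       (forall t p, 0 <= t -> inY X DS p ->
          normY X ip S (Tm t p) <= exp (mu * t) * normY X ip S p)).
Proof.
  assert (HApos' : forall x, DA x -> eps * norm x ^ 2 <= Re (ip x (A x))).
  { intros x Hx. rewrite <- (Re_ip_self Hip). apply Rge_le, HApos, Hx. }
  pose proof (pos_sqrt_linear DA A DS S HS) as HSlin.
  pose proof (pos_sqrt_sym DA A DS S HS) as HSsym.
  pose proof (pos_sqrt_domain DA A DS S HS) as HDA.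
  pose proof (pos_sqrt_sqr DA A DS S HS) as HAS.
  pose proof (pos_sqrt_dense DA A DS S HAdense HS) as HDS.
  destruct (pos_sqrt_inverse Hip DA A eps DS S HAlin HAdense HAsa Heps HApos' HS)
    as [Sinv [HSinv [HSinj [HSinvb HSinvlin]]]].
  assert (Hres : forall L f, 0 < L ->
    exists w, DS w /\ DS (S w) /\ plus (S (S w)) (scal (RtoC (L ^ 2)) w) = f).
  { intros L f HL.
    apply (coercive_shift_onto Hip DA A eps DS S HAlin HAdense HAsa Heps HApos' HS), pow2_ge_0. }
  set (K := fun u => Cop (Sinv u)).
  assert (HK : linear_on X (fun _ => True) K).
  { split; [repeat split|]. unfold K. split.
    - intros x y _ _. rewrite (linear_on_plus HSinvlin) by trivial. apply (linear_on_plus HClin); apply HSinv.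
    - intros l x _. rewrite (linear_on_scal HSinvlin) by trivial. apply (linear_on_scal HClin), HSinv. }
  (* From [|C S^-1 u|^2 <= c^2 |u|^2 + d^2 |S^-1 u|^2] and [eps |S^-1 u|^2 <= |u|^2]. *)
  set (k := sqrt (c ^ 2 + d ^ 2 / eps)).
  assert (Hd : 0 <= d ^ 2 / eps).
  { apply Rmult_le_pos; [apply pow2_ge_0|]. apply Rlt_le, Rinv_0_lt_compat, Heps. }
  assert (Hk : 0 <= k) by apply sqrt_pos.
  assert (Ek : k ^ 2 = c ^ 2 + d ^ 2 / eps) by (apply pow2_sqrt; pose proof (pow2_ge_0 c); lra).
  assert (HKk : forall u, norm (K u) <= k * norm u).
  { intros u. destruct (HSinv u) as [Du Eu]. specialize (HCbd _ Du). rewrite Eu in HCbd. fold (K u) in HCbd.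
    specialize (HSinvb u). pose proof (norm_ge_0 u).
    apply Rnot_lt_le. intros Hc.
    assert (Hsq : (k * norm u) ^ 2 < norm (K u) ^ 2).
    { assert (0 <= k * norm u) by (apply Rmult_le_pos; assumption). nra. }
    rewrite Rpow_mult_distr, Ek in Hsq.
    assert (d ^ 2 * norm (Sinv u) ^ 2 <= d ^ 2 / eps * norm u ^ 2).
    { replace (d ^ 2 * norm (Sinv u) ^ 2) with (d ^ 2 / eps * (eps * norm (Sinv u) ^ 2)) by (field; lra).
      apply Rmult_le_compat_l; assumption. }
    lra. }
  destruct (symmetric_or_bounded_form DS B Hip HBsym) as [M [HM HBM]].
  split.
  - destruct (wave_op_onto Hip DS S B K k HSlin HSsym HBlin HK HKk a b Ha HBbd Hres) as [L0 HL].
    apply (generation_transfer Hip DA DS S Sinv 1 HSlin HDA HSinv HSinj (Rmult_1_l 1) _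
             (wave_op S B K)) with L0; try assumption.
    + apply (wave_op_linear Hip); assumption.
    + intros [x y] [Hx Hy]. unfold inY, Gplus, scalY, plusY, H_op, Bhat_op, V_op. cbn [fst snd] in *.
      apply (domain_scal HSlin). repeat apply (domain_plus HSlin); try apply (domain_zero HSlin).
      apply (domain_scal HSlin), Hy.
    + intros [x y] [Hx Hy]. unfold to_prod, wave_op, Gplus, scalY, plusY, H_op, Bhat_op, V_op, K.
      cbn [fst snd] in *. destruct (proj1 (HDA x) Hx) as [Dx DSx]. rewrite (HSinj x Dx), <- (HAS x Hx).
      f_equal.
      * rewrite <- (linear_on_scal HSlin) by (apply (domain_scal HSlin), Hy).
        f_equal. vec Hip. apply injective_projections; simpl; ring.
      * replace (scal (RtoC 1) y) with y by vec Hip. vec Hip. apply injective_projections; simpl; ring.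
    + exists (M + k). apply (wave_op_accretive Hip); try assumption.
      intros v Hv. specialize (HBM v Hv). apply Rabs_le_between in HBM. lra.
  (* Reversing the sign of the second component restores the skew part and [K] in [G_-] but leaves
     [- i B v]; [B'] absorbs this sign and satisfies the same bounds as [B]. *)
  - set (B' := fun x => scal (RtoC (-1)) (B x)).
    assert (HB' : linear_on X DS B').
    { split; [apply HBlin|]. unfold B'. split.
      - intros x y Hx Hy. rewrite (linear_on_plus HBlin) by assumption. vec Hip.
      - intros l x Hx. rewrite (linear_on_scal HBlin) by assumption. vec Hip. }
    assert (HB'bd : forall x, DS x -> norm (B' x) ^ 2 <= a ^ 2 * norm (S x) ^ 2 + b ^ 2 * norm x ^ 2).
    { intros x Hx. unfold B'. rewrite norm_scal_C, Cmod_R, Rabs_left by lra.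
      replace (- -1 * norm (B x)) with (norm (B x)) by ring. apply HBbd, Hx. }
    destruct (wave_op_onto Hip DS S B' K k HSlin HSsym HB' HK HKk a b Ha HB'bd Hres) as [L0 HL].
    apply (generation_transfer Hip DA DS S Sinv (-1) HSlin HDA HSinv HSinj ltac:(ring) _
             (wave_op S B' K)) with L0; try assumption.
    + apply (wave_op_linear Hip); assumption.
    + intros [x y] [Hx Hy]. unfold inY, Gminus, scalY, plusY, H_op, Bhat_op, V_op. cbn [fst snd] in *.
      apply (domain_scal HSlin). repeat apply (domain_plus HSlin); try apply (domain_zero HSlin).
      apply (domain_scal HSlin), Hy.
    + intros [x y] [Hx Hy]. unfold to_prod, wave_op, Gminus, scalY, plusY, H_op, Bhat_op, V_op, K, B'.
      cbn [fst snd] in *. destruct (proj1 (HDA x) Hx) as [Dx DSx]. rewrite (HSinj x Dx), <- (HAS x Hx).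
      f_equal.
      * rewrite <- (linear_on_scal HSlin) by (apply (domain_scal HSlin), Hy).
        f_equal. vec Hip. apply injective_projections; simpl; ring.
      * rewrite (linear_on_scal HBlin) by assumption. vec Hip. apply injective_projections; simpl; ring.
    + exists (M + k). apply (wave_op_accretive Hip); try assumption.
      intros v Hv. specialize (HBM v Hv). apply Rabs_le_between in HBM. unfold B'.
      rewrite (ip_scal_r Hip).
      replace (Ci * (RtoC (-1) * ip v (B v)))%C with (RtoC (-1) * (Ci * ip v (B v)))%C by ring.
      rewrite re_scal_l. lra.
Qed.
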